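(* The multivariable Jacobi polynomials $J_p(n;z;\gamma)$, $n\in\mathbb{N}_0^p$, satisfy, for $j=1,2,\dots,p$, the spectral equations $$\hat{\mathfrak L}^z_j\,J_p(n;z;\gamma)=\hat\mu_j(n)\,J_p(n;z;\gamma),$$ $$\hat{\mathfrak L}^n_j\,J_p(n;z;\gamma)=\hat\kappa_j(z)\,J_p(n;z;\gamma),$$ where $$\hat\mu_j(n)=-(n_1+\cdots+n_j)(n_1+\cdots+n_j+j+\gamma_1+\cdots+\gamma_{j+1}),\qquad \hat\kappa_j(z)=1-z_1-z_2-\cdots-z_{p+1-j},$$ and $\hat{\mathfrak L}^z_j$ (a differential operator in $z$) and $\hat{\mathfrak L}^n_j$ (a difference operator in $n$) are the operators defined in the context.
   Context: Notation: $p\ge1$, $z=(z_1,\dots,z_p)$, real parameters $\gamma=(\gamma_1,\dots,\gamma_{p+1})$, $z_{p+1}=1-|z|$, $Z_1^k=z_1+\cdots+z_k$ (so $Z_1^{p+1}=1$), $\gamma_1^k=\gamma_1+\cdots+\gamma_k$, $|n|=n_1+\cdots+n_p$, $N_1^k=n_1+\cdots+n_k$, $N_1^0=0$, $(a)_k=a(a+1)\cdots(a+k-1)$. Jacobi polynomials: with $P_n(x;\alpha,\beta)=\frac{(\alpha+1)_n}{n!}\,{}_2F_1\!\left[\begin{matrix}-n,\ n+\alpha+\beta+1\\ \alpha+1\end{matrix};\frac{1-x}{2}\right]$, $$J_p(n;z;\gamma)=(-1)^{|n|}\prod_{k=1}^p\frac{n_k!\,(Z_1^{k+1})^{n_k}}{(\gamma_{k+1}+1)_{n_k}}\,P_{n_k}\!\left(1-2\frac{Z_1^k}{Z_1^{k+1}};\,2N_1^{k-1}+\gamma_1^k+k-1,\,\gamma_{k+1}\right).$$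 Operators in $z$: $$\hat{\mathfrak L}^z_j=-2\sum_{1\le l<m\le\min(j+1,p)}z_lz_m\frac{\partial^2}{\partial z_l\partial z_m}+\sum_{m=1}^{\min(j+1,p)}z_m(Z_1^{j+1}-z_m)\frac{\partial^2}{\partial z_m^2}+\sum_{m=1}^{\min(j+1,p)}\big((\gamma_m+1)Z_1^{j+1}-(\gamma_1^{j+1}+j+1)z_m\big)\frac{\partial}{\partial z_m}.$$ Operators in $n$: First, for $q\ge1$ define $\mathcal{L}_q(x_1,\dots,x_q;\beta_0,\dots,\beta_{q+1};M)$ as follows. Let $E_{x_i}f(x)=f(x+e_i)$, $\triangle_{x_i}=E_{x_i}-1$, $\nabla_{x_i}=1-E_{x_i}^{-1}$ (with multi-index powers), and for $1\le i\le q$ let $I_i$ be the substitution $x_i\mapsto -x_i-\beta_i$ (everything else fixed) on rational functions. For $\nu\in\{0,1\}^q\setminus\{0\}$ with nonzero components at positions $i_1<\cdots<i_s$ put $$A_\nu=(x_{i_1}+\beta_{i_1}-\beta_0)(x_{i_1}+\beta_{i_1})\,\frac{\prod_{k=2}^s(x_{i_k}+x_{i_{k-1}}+\beta_{i_k})(x_{i_k}+x_{i_{k-1}}+\beta_{i_k}+1)}{\prod_{k=1}^s(2x_{i_k}+\beta_{i_k})(2x_{i_k}+\beta_{i_k}+1)}\,(x_{i_s}+\beta_{q+1}+M)(M-x_{i_s}).$$ With $\nu_j^+=\max(\nu_j,0)$, $\nu_j^-=-\min(\nu_j,0)$, for $\nu\in\{-1,0,1\}^q\setminus\{0,1\}^q$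 put $A_\nu=I^{\nu^-}(A_{\nu^++\nu^-})$, where $I^{\nu^-}$ is the composition of the $I_i$ with $\nu_i^-=1$; then $\mathcal{L}_q=\sum_{\nu\in\{-1,0,1\}^q\setminus\{0\}}(-1)^{|\nu^-|}A_\nu\triangle_x^{\nu^+}\nabla_x^{\nu^-}$. For $j=1,\dots,p$ put $\mathfrak{L}^x_j=\mathcal{L}_j(x_1,\dots,x_j;\beta_0,\dots,\beta_{j+1};x_{j+1})$ with $x_{p+1}=N$. Let $\mathfrak b$ be the algebra isomorphism from difference operators in $x=(x_1,\dots,x_p)$ with coefficients rational in $x,\beta,N$ to difference operators in $n=(n_1,\dots,n_p)$ with coefficients rational in $n,\beta,N$ determined by $\mathfrak b(N)=N$, $\mathfrak b(\beta_0)=\beta_0$, $\mathfrak b(\beta_k)=\beta_0-\beta_{p+2-k}-2N+1$ ($1\le k\le p+1$), $\mathfrak b(x_k)=n_1+\cdots+n_{p+1-k}+\beta_{p+2-k}-\beta_0+N-1$ and $\mathfrak b(E_{x_k})=E_{n_{p+1-k}}E_{n_{p+2-k}}^{-1}$ ($1\le k\le p$), with $E_{n_{p+1}}$ the identity. Put $\mathfrak{L}^n_j=\mathfrak b(\mathfrak{L}^x_j)$, and let $\mathfrak{L}^n_j(\beta_0,\gamma,N)$ be $\mathfrak{L}^n_j$ after the substitution $\beta_k=\beta_0+\gamma_1^k+k$ for $k=1,\dots,p+1$. Finally $$\tilde{\mathfrak L}^n_j=\lim_{\beta_0\to\infty}\frac1{\beta_0}\,\mathfrak{L}^n_j(\beta_0,\gamma,N),\qquad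 \hat{\mathfrak L}^n_j=\lim_{N\to\infty}\frac1N\,\tilde{\mathfrak L}^n_j,$$ the limits being taken coefficientwise in the expansion in powers of the shifts $E_{n_i}^{\pm1}$. Conventions: the parameters $\gamma$ are assumed to be such that the denominators occurring (in $J_p$ and, at the points $n$ considered, in the coefficients of $\hat{\mathfrak L}^n_j$) do not vanish; terms of $\hat{\mathfrak L}^n_jJ_p$ involving an index with a negative component have vanishing coefficient and are taken to be $0$. *)

(* Defs.v *)
From HB Require Import structures.
From mathcomp Require Import all_boot all_order all_algebra.
From mathcomp Require Import ring.
From mathcomp Require Import all_classical all_reals all_analysis.
(* the notations of mpoly clash with those of mathcomp-analysis *)
From mathcomp Require mpoly.
Export -(notations) mpoly.
Set Implicit Arguments.
Unset Strict Implicit.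
Unset Printing Implicit Defensive.
Import Order.TTheory GRing.Theory Num.Theory.
Import numFieldNormedType.Exports.
Local Open Scope ring_scope.

Notation mpol R p := (mpoly p R).
Notation mvar R i := (mpolyX R (mnm1 i)).
Notation "''d_' i f" := (mderiv i f)
  (at level 10, i at level 8, f at level 9, format "''d_' i  f").

(** Families v = (v_1, ..., v_m) are functions on 'I_m.  The formulas below use
    the customary indices 1, ..., m, as natural numbers. *)

(* v_k for 1 <= k <= m, and 0 for the other k *)
Definition at1 (V : nmodType) m (v : 'I_m -> V) (k : nat) : V :=
  \sum_(i < m | i.+1 == k) v i.

(* v_1 + ... + v_k *)
Definition psum (V : nmodType) m (v : 'I_m -> V) (k : nat) : V :=
  \sum_(i < m | (i < k)%N) v i.

(** * Jacobi polynomials *)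

Section Jacobi.
Variable R : realType.

Definition poch (a : R) (k : nat) : R := \prod_(i < k) (a + i%:R).

(* 2F1(-n, b; c; y), a polynomial in y *)
Definition hyp2F1 (n : nat) (b c : R) (y : {poly R}) : {poly R} :=
  \sum_(m < n.+1) (poch (- n%:R) m * poch b m / (poch c m * m`!%:R)) *: y ^+ m.

Definition jacobi (n : nat) (a b : R) : {poly R} :=
  (poch (a + 1) n / n`!%:R) *:
    hyp2F1 n (n%:R + a + b + 1) (a + 1) (2^-1 *: (1 - 'X)).

(* Y ^ n * q(X / Y), for q of degree at most n *)
Definition homog (A : comAlgType R) (n : nat) (q : {poly R}) (X Y : A) : A :=
  \sum_(i < n.+1) q`_i *: (X ^+ i * Y ^+ (n - i)).

Variable p : nat.
Implicit Types (gamma : 'I_p.+1 -> R) (n : 'I_p -> nat).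

(* Z_1^k, for 1 <= k <= p + 1 *)
Definition Zsum (k : nat) : mpol R p :=
  if (k <= p)%N then psum (fun i : 'I_p => mvar R i) k else 1.

(* the first parameter of the k-th Jacobi factor *)
Definition Jalpha gamma n (k : nat) : R :=
  2 * (psum n k.-1)%:R + psum gamma k + k%:R - 1.

(* P_{n_k}(1 - 2 Z_1^k / Z_1^{k+1}) multiplied by (Z_1^{k+1})^{n_k} is written as
   a homogeneous polynomial in Z_1^k and Z_1^{k+1}; see [Jpoly_eval]. *)
Definition Jpoly gamma n : mpol R p :=
  (-1) ^+ (\sum_(i < p) n i)%N *
  \prod_(1 <= k < p.+1)
    (((at1 n k)`!%:R / poch (at1 gamma k.+1 + 1) (at1 n k)) *:
      homog (at1 n k)
        (jacobi (at1 n k) (Jalpha gamma n k) (at1 gamma k.+1) \Po (1 - 2 *: 'X))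
        (Zsum k) (Zsum k.+1)).

(* no denominator of J_p(n; z; gamma) vanishes, for n in N^p; the (alpha + 1)_m,
   m <= n_k, are the denominators of the 2F1 in P_{n_k} *)
Definition Jpoly_defined gamma : Prop :=
  forall n (k : nat), (1 <= k <= p)%N ->
    poch (at1 gamma k.+1 + 1) (at1 n k) != 0 /\
    poch (Jalpha gamma n k + 1) (at1 n k) != 0.

(** * The operators in z *)

(* indices l, m : 'I_p stand for l + 1, m + 1 *)
Definition Lz gamma (j : nat) (f : mpol R p) : mpol R p :=
  - 2 *: (\sum_(l < p) \sum_(m < p | (l < m)%N && (m < minn j.+1 p)%N)
            mvar R l * mvar R m * 'd_l ('d_m f))
  + \sum_(m < p | (m < minn j.+1 p)%N)
      mvar R m * (Zsum j.+1 - mvar R m) * 'd_m ('d_m f)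
  + \sum_(m < p | (m < minn j.+1 p)%N)
      ((at1 gamma m.+1 + 1) *: Zsum j.+1
        - (psum gamma j.+1 + j.+1%:R) *: mvar R m) * 'd_m f.

Definition mu_hat gamma n (j : nat) : R :=
  - ((psum n j)%:R * ((psum n j)%:R + j%:R + psum gamma j.+1)).

Definition kappa_hat (j : nat) : mpol R p :=
  1 - psum (fun i : 'I_p => mvar R i) (p.+1 - j).

End Jacobi.

(** * Difference operators in x and in n *)

Section Difference.
Variables (R : realType) (p : nat).

(* A rational function of (x, beta, N), as the function of its values.  Only
   beta_0, ..., beta_{p+1} are used. *)
Definition coefn := ('I_p -> R) -> (nat -> R) -> R -> R.

(* s stands for the shift E_1^{s_1} ... E_p^{s_p} *)
Definition multishift := {ffun 'I_p -> int}.

(* [:: (c_1, s_1); ...; (c_r, s_r)] stands for c_1 E^{s_1} + ... + c_r E^{s_r};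
   a shift may occur more than once, and the sum of operators is cat. *)
Definition dop := seq (coefn * multishift).

Definition translate (s : multishift) (x : 'I_p -> R) : 'I_p -> R :=
  fun i => x i + (s i)%:~R.

(* (c E^s) (d E^t) = c (E^s d) E^{s+t} *)
Definition dcomp (L1 L2 : dop) : dop :=
  [seq (((fun x beta N => t1.1 x beta N * t2.1 (translate t1.2 x) beta N) : coefn),
        t1.2 + t2.2) | t1 <- L1, t2 <- L2].

(* the coefficient of E^s in L *)
Definition dcoef (L : dop) (s : multishift) : coefn :=
  fun x beta N => \sum_(t <- L | t.2 == s) t.1 x beta N.

Definition const_coefn (a : R) : coefn := fun _ _ _ => a.

(* the shift E_k; for k = p + 1 it is the identity *)
Definition unit_shift (k : nat) : multishift := [ffun i : 'I_p => (i.+1 == k)%:Z].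

Definition dscal (c : coefn) : dop := [:: (c, 0)].
Definition Delta_ (k : nat) : dop :=
  [:: (const_coefn 1, unit_shift k); (const_coefn (-1), 0)].
Definition Nabla_ (k : nat) : dop :=
  [:: (const_coefn 1, 0); (const_coefn (-1), - unit_shift k)].

(* the substitution x_i |-> - x_i - beta_i *)
Definition reflect_var (i : nat) (c : coefn) : coefn :=
  fun x beta N => c (fun l => if l.+1 == i then - x l - beta i else x l) beta N.

(* A_nu for nu in {0,1}^q with nonzero components at the positions
   s = [:: i_1; ...; i_s], i_1 < ... < i_s.  The third argument is M. *)
Definition A01 (q : nat) (s : seq nat) : coefn := fun x beta M =>
  let X := at1 x in
  let i_1 := head 0%N s in
  let i_s := last 0%N s in
  (X i_1 + beta i_1 - beta 0%N) * (X i_1 + beta i_1) *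
  ((\prod_(1 <= k < size s)
      ((X (nth 0%N s k) + X (nth 0%N s k.-1) + beta (nth 0%N s k)) *
       (X (nth 0%N s k) + X (nth 0%N s k.-1) + beta (nth 0%N s k) + 1))) /
   (\prod_(i <- s) ((2 * X i + beta i) * (2 * X i + beta i + 1)))) *
  (X i_s + beta q.+1 + M) * (M - X i_s).

Definition positions (q : nat) (S : {set 'I_q}) : seq nat :=
  [seq (val i).+1 | i <- enum S].

(* nu in {-1,0,1}^q is given by P = {i | nu_i = 1} and Q = {i | nu_i = -1} *)
Definition A_ (q : nat) (P Q : {set 'I_q}) : coefn :=
  foldr reflect_var (A01 q (positions (P :|: Q))) (positions Q).

(* L_q(x_1, ..., x_q; beta_0, ..., beta_{q+1}; M) *)
Definition Lq (q : nat) : dop :=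
  \big[cat/[::]]_(nu : {set 'I_q} * {set 'I_q} |
                  [disjoint nu.1 & nu.2] && (nu.1 :|: nu.2 != finset.set0))
    dcomp (dscal (const_coefn ((-1) ^+ #|nu.2|)))
      (dcomp (dscal (A_ nu.1 nu.2))
        (dcomp (foldr dcomp (dscal (const_coefn 1)) (map Delta_ (positions nu.1)))
               (foldr dcomp (dscal (const_coefn 1)) (map Nabla_ (positions nu.2))))).

(* L^x_j, i.e. M := x_{j+1}, with x_{p+1} = N *)
Definition Lx (j : nat) : dop :=
  [seq (((fun x beta N =>
            t.1 x beta (if j == p then N else at1 x j.+1)) : coefn), t.2)
     | t <- Lq j].

(* The images under the isomorphism b of beta, x and the shifts in x; N is
   fixed by b. *)
Definition b_beta (beta : nat -> R) (N : R) : nat -> R := fun k =>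
  if k == 0%N then beta 0%N else beta 0%N - beta (p.+2 - k)%N - 2 * N + 1.

Definition b_x (n : 'I_p -> R) (beta : nat -> R) (N : R) : 'I_p -> R := fun i =>
  let k := i.+1 in
  psum n (p.+1 - k) + beta (p.+2 - k)%N - beta 0%N + N - 1.

Definition b_shift (s : multishift) : multishift :=
  \sum_(i < p) (let k := i.+1 in
    (unit_shift (p.+1 - k) - unit_shift (p.+2 - k)) *~ s i).

Definition b_dop (L : dop) : dop :=
  [seq (((fun n beta N => t.1 (b_x n beta N) (b_beta beta N) N) : coefn),
        b_shift t.2) | t <- L].

Definition Ln (j : nat) : dop := b_dop (Lx j).

Variable gamma : 'I_p.+1 -> R.

(* beta_k := beta_0 + gamma_1^k + k (for k = 0 this is beta_0) *)
Definition beta_gamma (beta0 : R) : nat -> R :=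
  fun k => beta0 + psum gamma k + k%:R.

(* the coefficients of E_n^s in the operators obtained from L^n_j in the limits *)
Definition Ln_tilde (j : nat) (s : multishift) (n : 'I_p -> R) (N : R) : R :=
  lim (beta0^-1 * dcoef (Ln j) s n (beta_gamma beta0) N @[beta0 --> +oo])%classic.

Definition Ln_hat (j : nat) (s : multishift) (n : 'I_p -> R) : R :=
  lim (N^-1 * Ln_tilde j s n N @[N --> +oo])%classic.

(* No denominator (2 x_k + beta_k)(2 x_k + beta_k +- 1) of the coefficients of
   L^n_j vanishes at n.  They depend neither on beta_0 nor on N, and they are
   the denominators that remain in the limits; see [Ln_denominator]. *)
Definition Ln_defined (j : nat) (n : 'I_p -> R) : Prop :=
  forall (beta0 N : R) (i : 'I_p), (i < j)%N ->
    let beta := beta_gamma beta0 in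
    let d := 2 * b_x n beta N i + b_beta beta N i.+1 in
    [/\ d != 0, d + 1 != 0 & d - 1 != 0].

(* f(n + s), and 0 when n + s has a negative component *)
Definition shifted (V : nmodType) (f : ('I_p -> nat) -> V) (s : multishift)
    (n : 'I_p -> nat) : V :=
  if [forall i, 0 <= (n i)%:Z + s i] then f (fun i => absz ((n i)%:Z + s i)) else 0.

(* the limit operator acting on functions of n; the shifts that do not occur in
   L^n_j have coefficient 0 *)
Definition Ln_hat_app (j : nat) (V : lmodType R) (f : ('I_p -> nat) -> V)
    (n : 'I_p -> nat) : V :=
  \sum_(s <- undup (unzip2 (Ln j)))
    Ln_hat j s (fun i => (n i)%:R) *: shifted f s n.

End Difference.

(** * Checks of the encodings *)

Lemma Ln_denominator (R : realType) (p : nat) (gamma : 'I_p.+1 -> R)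
    (n : 'I_p -> R) (beta0 N : R) (i : 'I_p) :
  let beta := beta_gamma gamma beta0 in
  2 * b_x n beta N i + b_beta p beta N i.+1 =
  2 * psum n (p - i) + psum gamma (p - i).+1 + (p - i)%:R.
Proof.
rewrite /b_x /b_beta /= subSS.
have -> : (p.+2 - i.+1 = (p - i).+1)%N by rewrite subSS subSn // ltnW.
rewrite /beta_gamma.
have -> : psum gamma 0 = 0 by rewrite /psum big_pred0.
rewrite -natr1.
set a := psum n _; set g := psum gamma _; set m := (p - i)%:R.
ring.
Qed.

Section JpolyEval.
Variables (R : realType) (p : nat).

Lemma size_jacobi_comp (n : nat) (a b : R) :
  (size (jacobi n a b \Po (1 - 2 *: 'X)) <= n.+1)%N.
Proof.
rewrite /jacobi /hyp2F1 linearZ /= raddf_sum /=.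
apply: leq_trans (size_scale_leq _ _) _.
apply: leq_trans (size_sum _ _ _) _; apply/bigmax_leqP => m _.
rewrite linearZ /= rmorphXn /= linearZ /= rmorphB /= rmorph1 /= comp_polyX.
have -> : 2^-1 *: (1 - (1 - 2 *: 'X)) = 'X :> {poly R}.
  by rewrite opprB addrC subrK scalerA mulVf ?scale1r // pnatr_eq0.
by apply: leq_trans (size_scale_leq _ _) _; rewrite size_polyXn ltnS -ltnS.
Qed.

Lemma meval_homog (v : 'I_p -> R) (n : nat) (q : {poly R}) (X Y : mpol R p) :
  (size q <= n.+1)%N -> meval v Y != 0 ->
  meval v (homog n q X Y) =
  meval v Y ^+ n * q.[meval v X / meval v Y].
Proof.
move=> qn Y0; rewrite raddf_sum /= (horner_coef_wide _ qn) mulr_sumr.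
apply: eq_bigr => i _; rewrite mevalZ rmorphM !rmorphXn /=.
have i_n : (i <= n)%N by rewrite -ltnS.
have -> : meval v Y ^+ n = meval v Y ^+ (n - i) * meval v Y ^+ i.
  by rewrite -exprD subnK.
rewrite expr_div_n; field.
by rewrite expf_neq0.
Qed.

Lemma Jpoly_eval (gamma : 'I_p.+1 -> R) (n : 'I_p -> nat) (z : 'I_p -> R) :
  let Z k := if (k <= p)%N then psum z k else 1 in
  (forall k, (1 < k <= p)%N -> Z k != 0) ->
  meval z (Jpoly gamma n) =
  (-1) ^+ (\sum_(i < p) n i)%N *
  \prod_(1 <= k < p.+1)
    ((at1 n k)`!%:R * Z k.+1 ^+ at1 n k / poch (at1 gamma k.+1 + 1) (at1 n k) *
     (jacobi (at1 n k) (Jalpha gamma n k) (at1 gamma k.+1)).[1 - 2 * (Z k / Z k.+1)]).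
Proof.
move=> Z Z0.
have evZ k : meval z (Zsum R p k) = Z k.
  rewrite /Zsum /Z; case: leqP => _; last by rewrite rmorph1.
  by rewrite raddf_sum /=; apply: eq_bigr => i _; rewrite mevalXU.
rewrite rmorphM rmorphXn /= rmorphN1 rmorph_prod /=; congr (_ * _).
rewrite !big_nat; apply: eq_bigr => k /andP[k1 kp].
have Zk : Z k.+1 != 0.
  have [kp'|kp'] := leqP k.+1 p; first by apply: Z0; rewrite ltnS k1.
  by rewrite /Z leqNgt kp' oner_eq0.
rewrite mevalZ meval_homog ?size_jacobi_comp ?evZ //.
rewrite horner_comp; set P := jacobi _ _ _.
have -> : (1 - 2 *: 'X).[Z k / Z k.+1] = 1 - 2 * (Z k / Z k.+1).
  by rewrite hornerD hornerN hornerZ hornerX hornerC.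
ring.
Qed.

End JpolyEval.

(* Main.v *)
From HB Require Import structures.
Require Import Defs.
From mathcomp Require Import all_boot all_order all_algebra.
From mathcomp Require Import ring zify.
From mathcomp Require Import all_classical all_reals all_analysis.
Set Implicit Arguments.
Unset Strict Implicit.
Unset Printing Implicit Defensive.
Import GRing.Theory Num.Theory.
Local Open Scope ring_scope.

(** The k-th factor of J_p is treated as a binary form of degree n_k in
    X = Z_1^k and Y = Z_1^{k+1} ([factor]); its first Jacobi parameter contains
    the degree N_1^{k-1} of the product of the factors below.

    The equation in z.  Let E be the Euler operator and
    B = sum_i (z_i d_i^2 + (gamma_i + 1) d_i), both in the first min(j+1,p)
    variables.  Then L_j = Z_1^{j+1} B - E (E + c), with
    c = gamma_1^{j+1} + j ([Lz_bessel]), and this operator commutes with the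
    multiplication by Z_1^k for k > j ([Lz_Zsum]), so only the product of the
    first j factors matters.  If U is the product of the first j-1 factors,
    then B U = 0 and E U = N U, and L_j acts on the X^i U by a two-term formula
    which, combined with the recurrence of the hypergeometric coefficients,
    gives the eigenvalue ([Lz_factor]).  Conversely, for a homogeneous
    polynomial the eigenvalue equation says that B annihilates it, which is
    what the next factor needs ([harmonic_factor_prod]).

    The equation in n.  A coefficient A_nu is a product along the chain of
    the sites where nu does not vanish, and the limits only remove its first
    two factors ([A_eval]).  Each factor that links two sites is quadratic in
    the variable of either site.  Summing over nu site by site, from the
    lowest factor of J_p that is involved up to the highest, one therefore
    carries a quadratic polynomial q.  The key fact is that the terms of one
    site, where the difference operators have been expanded into shifts,
    decompose q in a basis of three quadratic polynomials, one for each of the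
    shifts 1, 0, -1 of the site ([level_quad_decomp], [chain_sum_step]).  So the
    coefficient of a shift is a product of transition weights, one for each
    level.  These are the weights of the relations
      X^e g_n(a) = sum over f <= 2 of t_{e,f} Y^f g_{n+e-f}(a + 2 - 2e)
    for the form g_n(a) of degree n with first parameter a
    ([jacobi_form_three_term]), which follow from two contiguous relations.  A
    factor multiplied by Z_1^k to the power e thus passes a power of Z_1^{k+1}
    to the next one, while the degree of the factors up to k changes by
    1 - f.  Starting from one factor Z_1^{p+1-j} and ending with Z_1^{p+1} = 1,
    the sum over all shifts is Z_1^{p+1-j} J_p ([chain_sum_Jpoly]). *)

(** * Jacobi polynomials as binary forms *)

(** For a nonlinear goal that follows from one equation; the multiplier k is
    found by hand and the rest is left to ring or field. *)
Lemma eq_of_multiple (R : pzRingType) (x y l r k : R) :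
  l = r -> x - y = k * (l - r) -> x = y.
Proof. by move=> -> /eqP; rewrite subrr mulr0 subr_eq0 => /eqP. Qed.

Section JacobiForms.
Variable R : realType.
Implicit Types (a b c : R) (n i k : nat).

Lemma poch0 a : poch a 0 = 1.
Proof. exact: big_ord0. Qed.

Lemma pochSr a k : poch a k.+1 = poch a k * (a + k%:R).
Proof. by rewrite /poch big_ord_recr. Qed.

Lemma pochSl a k : poch a k.+1 = a * poch (a + 1) k.
Proof.
rewrite /poch big_ord_recl addr0; congr (_ * _); apply: eq_bigr => i _.
by rewrite lift0 -natr1; ring.
Qed.

Lemma poch_cat a k i : poch a (k + i) = poch a k * poch (a + k%:R) i.
Proof.
elim: i => [|i IH]; first by rewrite addn0 poch0 mulr1.
by rewrite addnS !pochSr IH natrD; ring.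
Qed.

Lemma poch_natN n i :
  poch (- n%:R) i = (-1) ^+ i * ('C(n, i) * i`!)%:R :> R.
Proof.
rewrite bin_ffact; elim: i => [|i IH]; first by rewrite poch0 ffactn0 mulr1.
rewrite pochSr IH ffactnSr exprSr natrM.
have [le_in|lt_ni] := leqP i n; first by rewrite natrB //; ring.
by rewrite ffact_small //; ring.
Qed.

(** The coefficient of X^i Y^(n-i) in
    (-1)^n n!/(b+1)_n Y^n P_n(1 - 2X/Y; a, b).  The quotient
    (a+1)_n / (a+1)_i is written as the Pochhammer symbol (a+1+i)_(n-i), so
    that no denominator involves a: the contiguous relations in a below then
    hold without a condition on a. *)
Definition form_coef n a b i : R :=
  (-1) ^+ (n + i) * 'C(n, i)%:R * poch (a + 1 + i%:R) (n - i) *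
  poch (n%:R + a + b + 1) i / poch (b + 1) n.

Lemma form_coef_jacobi n a b i : (i <= n)%N ->
  poch (a + 1) n != 0 ->
  (-1) ^+ n * (n`!%:R / poch (b + 1) n *
    (jacobi n a b \Po (1 - 2 *: 'X))`_i) = form_coef n a b i.
Proof.
move=> le_in nz; rewrite /jacobi /hyp2F1 linearZ /= raddf_sum /= coefZ coef_sum.
have step (m : 'I_n.+1) : (((poch (- n%:R) m * poch (n%:R + a + b + 1) m /
     (poch (a + 1) m * m`!%:R)) *: (2^-1 *: (1 - 'X)) ^+ m) \Po
     (1 - 2 *: 'X))`_i = poch (- n%:R) m * poch (n%:R + a + b + 1) m /
     (poch (a + 1) m * m`!%:R) * (i == m)%:R.
  rewrite linearZ /= rmorphXn /= linearZ /= rmorphB /= rmorph1 /= comp_polyX.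
  have -> : 2^-1 *: (1 - (1 - 2 *: 'X)) = 'X :> {poly R}.
    by rewrite opprB addrC subrK scalerA mulVf ?scale1r // pnatr_eq0.
  by rewrite coefZ coefXn.
under eq_bigr do rewrite step.
have lt_in : (i < n.+1)%N by rewrite ltnS.
rewrite (bigD1 (Ordinal lt_in)) //= eqxx mulr1 big1; last first.
  move=> m; rewrite -val_eqE /= eq_sym => /negbTE ->; exact: mulr0.
rewrite addr0 poch_natN /form_coef exprD natrM.
have pE : poch (a + 1) n = poch (a + 1) i * poch (a + 1 + i%:R) (n - i).
  by rewrite -poch_cat subnKC.
move: nz; rewrite pE mulf_eq0 negb_or => /andP[nz1 nz2].
have f0 k : k`!%:R != 0 :> R by rewrite pnatr_eq0 -lt0n fact_gt0.
set B := poch (b + 1) n.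
have := f0 n; have := f0 i; set u := poch _ _ in nz1 *; set f := i`!%:R; set g := n`!%:R.
move=> f1 g1.
case: (eqVneq B 0) => [->|nB]; first by rewrite invr0; ring.
by field; rewrite nB f1 g1 nz1.
Qed.

Lemma poch1l a k : (0 < k)%N -> poch a k = a * poch (a + 1) k.-1.
Proof. by case: k => // k _; rewrite pochSl. Qed.

Lemma form_coef_hypergeometric n a b i :
  i.+1%:R * (i%:R + a + 1) * form_coef n a b i.+1 =
  (i%:R - n%:R) * (i%:R + n%:R + a + b + 1) * form_coef n a b i.
Proof.
rewrite /form_coef addnS exprS pochSr.
have [lt_in|] := ltnP i n; last first.
  rewrite leq_eqVlt => /orP[/eqP<-|lt_ni]; first by rewrite bin_small //; ring.
  by rewrite !bin_small ?(leqW lt_ni) //; ring.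
have E : i.+1%:R * 'C(n, i.+1)%:R = (n%:R - i%:R) * 'C(n, i)%:R :> R.
  by rewrite -natrB 1?ltnW // -!natrM mul_bin_left.
rewrite (@poch1l _ (n - i)) ?subn_gt0 // -subnS -natr1.
set p1 := poch (_ + 1 + i%:R + 1) _; set p2 := poch (_ + (i%:R + 1)) _.
have -> : p2 = p1 by congr poch; ring.
set p3 := poch _ i; set c1 := 'C(n, i.+1)%:R in E *; set c2 := 'C(n, i)%:R in E *.
rewrite -natr1 in E *.
apply: (eq_of_multiple (k := (-1) * (-1) ^+ (n + i) * (i%:R + a + 1) * p1 * p3 *
  (n%:R + a + b + 1 + i%:R) / poch (b + 1) n) E).
ring.
Qed.

Lemma form_coef_small n a b i : (n < i)%N -> form_coef n a b i = 0.
Proof. by move=> lt_ni; rewrite /form_coef bin_small //; ring. Qed.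

(** After division by the common factors this is the identity
    (2n+a+b+1)(a+1+i) = (n+a+b+1+i)(n+a+1) - (n-i)(n+b), both sides of which
    are affine in i. *)
Lemma form_coef_raise n a b i : poch (b + 1) n != 0 ->
  (2 * n%:R + a + b + 1) * form_coef n a b i =
  (n%:R + a + b + 1) * form_coef n (a + 1) b i + n%:R * form_coef n.-1 (a + 1) b i.
Proof.
case: n => [|n] nz.
  case: i => [|i]; last by rewrite !form_coef_small //; ring.
  by rewrite /form_coef /= !poch0; field.
rewrite succnK.
have [lt_ni|le_in] := ltnP n.+1 i.
  by rewrite !form_coef_small ?(ltnW lt_ni) //; ring.
rewrite /form_coef addSn exprS.
move: nz; rewrite pochSr mulf_eq0 negb_or => /andP[nz1 nz2].
have E : n.+1%:R * 'C(n, i)%:R = (n.+1%:R - i%:R) * 'C(n.+1, i)%:R :> R.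
  by rewrite -natrB // -!natrM mul_bin_down.
have P3 : (n.+1%:R + a + b + 1) * poch (n.+1%:R + (a + 1) + b + 1) i =
    poch (n.+1%:R + a + b + 1) i * (n.+1%:R + a + b + 1 + i%:R).
  rewrite -pochSr pochSl; congr (_ * poch _ _); ring.
have -> : poch (n%:R + (a + 1) + b + 1) i = poch (n.+1%:R + a + b + 1) i.
  by congr poch; rewrite -natr1; ring.
move: E P3.
set p1 := poch (n.+1%:R + a + b + 1) i; set p2 := poch (_ + (a + 1) + b + 1) i.
set B := poch (b + 1) n; set sg := (-1) ^+ _.
case: (ltngtP i n.+1) le_in => // [lt_in|->] _ E P3; last first.
  have E0 : 'C(n, n.+1)%:R = 0 :> R by rewrite bin_small.
  rewrite E0 subnn !poch0 binn.
  have -> : (n.+1%:R + a + b + 1) * (-1 * sg * 1 * 1 * p2 / (B * (b + 1 + n%:R))) =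
    -1 * sg / (B * (b + 1 + n%:R)) * ((n.+1%:R + a + b + 1) * p2) by ring.
  by rewrite P3 -natr1; ring.
have p4E : poch (a + 1 + i%:R) (n.+1 - i) =
    (a + 1 + i%:R) * poch (a + 1 + 1 + i%:R) (n - i).
  by rewrite subSn // pochSl; congr (_ * poch _ _); ring.
have p5E : poch (a + 1 + 1 + i%:R) (n.+1 - i) =
    poch (a + 1 + 1 + i%:R) (n - i) * (a + 1 + 1 + n%:R).
  by rewrite subSn // pochSr natrB //; ring.
rewrite p4E p5E.
set p6 := poch (a + 1 + 1 + i%:R) _.
set c1 := 'C(n, i)%:R in E *; set c2 := 'C(n.+1, i)%:R in E *.
have -> : (n.+1%:R + a + b + 1) * (-1 * sg * c2 * (p6 * (a + 1 + 1 + n%:R)) * p2 /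
    (B * (b + 1 + n%:R))) = -1 * sg * c2 * (p6 * (a + 1 + 1 + n%:R)) /
    (B * (b + 1 + n%:R)) * ((n.+1%:R + a + b + 1) * p2) by ring.
have -> : n.+1%:R * (sg * c1 * p6 * p1 / B) = sg * p6 * p1 / B * (n.+1%:R * c1).
  ring.
rewrite P3 E -natr1.
by field; rewrite nz1 nz2.
Qed.

(** Multiplication by X, on the coefficients of a form. *)
Definition upshift (u : nat -> R) i : R := if i is i'.+1 then u i' else 0.

(** The relation adjoint to the raising one.  After division by
    the common factors it reduces to Pascal's rule and to
    (i+1) C(n,i+1) = (n-i) C(n,i). *)
Lemma form_coef_lower n a b i : poch (b + 1) n.+1 != 0 ->
  (2 * n%:R + a + b + 2) * upshift (form_coef n (a + 1) b) i =
  (n%:R + a + 1) * form_coef n a b i + (n%:R + b + 1) * form_coef n.+1 a b i.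
Proof.
move=> nz; rewrite /upshift.
have [lt_ni|le_in] := ltnP n.+1 i.
  rewrite (@form_coef_small n.+1) // (@form_coef_small n a) ?(ltnW lt_ni) //.
  by case: i lt_ni => [|i] // lt_ni; rewrite form_coef_small //; ring.
rewrite /form_coef.
move: nz; rewrite pochSr mulf_eq0 negb_or => /andP[nz1 nz2].
case: i le_in => [_|i le_in].
  rewrite !bin0 !subn0 !addn0 !poch0 exprS pochSr.
  by field; rewrite nz1 nz2.
rewrite !addSn !addnS !exprS.
have E1 : i.+1%:R * 'C(n, i.+1)%:R = (n%:R - i%:R) * 'C(n, i)%:R :> R.
  by rewrite -natrB // -!natrM mul_bin_left.
rewrite binS natrD.
set c1 := 'C(n, i.+1)%:R in E1 *; set c2 := 'C(n, i)%:R in E1 *.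
rewrite (pochSl (n%:R + a + b + 1)) (pochSr (n.+1%:R + a + b + 1)).
have -> : poch (n%:R + a + b + 1 + 1) i = poch (n.+1%:R + a + b + 1) i.
  by congr poch; rewrite -natr1; ring.
have -> : poch (n%:R + (a + 1) + b + 1) i = poch (n.+1%:R + a + b + 1) i.
  by congr poch; rewrite -natr1; ring.
have -> : poch (a + 1 + 1 + i%:R) (n - i) = poch (a + 1 + i.+1%:R) (n - i).
  by congr poch; rewrite -natr1; ring.
rewrite subSS.
set p1 := poch (n.+1%:R + a + b + 1) i; set p2 := poch (a + 1 + i.+1%:R) (n - i).
have p3E : c1 * ((n%:R + a + 1) * poch (a + 1 + i.+1%:R) (n - i.+1)) = c1 * p2.
  have [lt_in|le_ni] := ltnP i n; last by rewrite /c1 bin_small ?ltnS // !mul0r.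
  rewrite /p2 (_ : (n - i)%N = (n - i.+1).+1) ?pochSr; last by lia.
  by rewrite natrB // -natr1; ring.
set p3 := poch _ (n - i.+1) in p3E *.
set B := poch (b + 1) n; set sg := (-1) ^+ _.
have -> : (n%:R + a + 1) * (-1 * sg * c1 * p3 * ((n%:R + a + b + 1) * p1) / B) =
  -1 * sg * ((n%:R + a + b + 1) * p1) / B * (c1 * ((n%:R + a + 1) * p3)) by ring.
rewrite p3E.
rewrite -[i.+1%:R]natr1 in E1 *; rewrite -[n.+1%:R]natr1.
apply: (eq_of_multiple (k := - sg * p1 * p2 / B) E1).
by field; rewrite nz1 nz2.
Qed.

End JacobiForms.

Arguments upshift {R}.

(** * Three-term relations with shifted first parameter *)

Section ThreeTerm.
Variable R : realType.
Implicit Types (a b x y : R) (n i e f : nat).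

(** The index e stands for 1 - nu, where nu = 1, 0, -1 is the change of the
    degree of the lower factors, which changes the first Jacobi parameter by
    2 nu. *)
Definition quad e x y : R :=
  match e with 0 => x * (x + 1) | 1 => x * y | _ => y * (y + 1) end.

Definition trans_plus n a b e : R :=
  quad e (n%:R + a + b + 1) (n%:R + b + 1) /
    ((2 * n%:R + a + b + 1) * (2 * n%:R + a + b + 1 + 1)).

Definition trans_minus n a b e : R :=
  quad e (- n%:R) (- n%:R - a) /
    ((2 * n%:R + a + b + 1) * (2 * n%:R + a + b + 1 - 1)).

(** The weights of the forms of degrees n+e, n+e-1, n+e-2 in the
    three-term relation.  The normalized forms take the value 1 at
    X = Y = 1, so the weights add up to 1 and the middle one is determined
    by the others. *)
Definition trans_coef n a b e f : R :=
  match f with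
  | 0 => trans_plus n a b e
  | 1 => 1 - trans_plus n a b e - trans_minus n a b e
  | _ => trans_minus n a b e
  end.

(** Forms of negative degree are 0; this avoids the truncated
    subtraction. *)
Definition down_coef n f a b i : R := if (f <= n)%N then form_coef (n - f) a b i else 0.

Lemma down_coef0 n a b i : down_coef n 0 a b i = form_coef n a b i.
Proof. by rewrite /down_coef subn0. Qed.

Lemma down_coefS n f a b i : down_coef n.+1 f.+1 a b i = down_coef n f a b i.
Proof. by []. Qed.

(** The factor n makes the relation hold for n = 0 as well, where the
    form of degree n - 1 is absent. *)
Lemma down_coef_raise n a b i : poch (b + 1) n != 0 ->
  n%:R * ((2 * n%:R + a + b + 1 - 1) * down_coef n 1 (a + 1) b i) =
  n%:R * ((n%:R + a + b + 1) * down_coef n 1 (a + 1 + 1) b i +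
          (n%:R - 1) * down_coef n 2 (a + 1 + 1) b i).
Proof.
case: n => [|n nz]; first by rewrite !mul0r.
have nz' : poch (b + 1) n != 0.
  by move: nz; rewrite pochSr mulf_eq0 negb_or => /andP[].
congr (_ * _); rewrite /down_coef /= subn1 /=.
have N1 : n.+1%:R = n%:R + 1 :> R by rewrite natr1.
have := form_coef_raise (a + 1) i nz'; rewrite N1.
case: n {nz nz' N1} => [|n] /= E; last rewrite subSS subn1 /=.
  by apply: etrans (etrans _ E) _; ring.
by apply: etrans (etrans _ E) _; ring.
Qed.

Lemma down_coef_lower n a b i : poch (b + 1) n != 0 ->
  n%:R * ((2 * n%:R + a + b + 1 - 1) * upshift (down_coef n 1 (a + 1) b) i) =
  n%:R * ((n%:R + a) * down_coef n 1 a b i + (n%:R + b) * form_coef n a b i).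
Proof.
case: n => [|n nz]; first by rewrite !mul0r.
have E := form_coef_lower a i nz.
congr (_ * _); rewrite -natr1.
have -> : upshift (down_coef n.+1 1 (a + 1) b) i = upshift (form_coef n (a + 1) b) i.
  by case: i {E} => [|i] //=; rewrite /down_coef subn1.
rewrite /down_coef /= subn1 /=.
apply: etrans (etrans _ E) _; ring.
Qed.

Lemma upshift_lin (k l : R) (u v w : nat -> R) i :
  (forall i, u i = k * v i + l * w i) ->
  upshift u i = k * upshift v i + l * upshift w i.
Proof. by move=> E; case: i => [|i] //=; rewrite !mulr0 addr0. Qed.

(** X^e times the form with parameter a is written in forms
    with parameter a + 2 - 2e by two contiguous relations: raise twice if
    e = 0, raise and lower if e = 1, lower twice if e = 2.  The intermediate
    parameter is a + 1 for e < 2 and a - 1 for e = 2; the first relation has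
    denominator D = 2n+a+b+1, the second one D + 1 or D - 1, according to the
    degree of the form to which it is applied. *)
Lemma form_coef_three_term n a b e i :
  (forall m, poch (b + 1) m != 0) -> (e < 3)%N ->
  2 * n%:R + a + b + 1 != 0 ->
  2 * n%:R + a + b + 1 + 1 != 0 ->
  2 * n%:R + a + b + 1 - 1 != 0 ->
  iter e upshift (form_coef n a b) i =
  \sum_(f < 3) trans_coef n a b e f * down_coef (n + e) f (a + 2 - 2 * e%:R) b i.
Proof.
move=> nzb lt_e nD nDp nDm.
rewrite !big_ord_recl big_ord0 addr0 /= /trans_plus /trans_minus.
set D := 2 * n%:R + a + b + 1 in nD nDp nDm *.
have divE (k u v : R) : k != 0 -> k * u = v -> u = v / k.
  by move=> nk <-; field.
case: e lt_e => [|[|[|//]]] _ /=; rewrite ?addn0.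
- have -> : a + 2 - 2 * 0%:R = a + 1 + 1 by ring.
  have E1 := divE _ _ _ nD (form_coef_raise a i (nzb n)).
  have E2 : form_coef n (a + 1) b i = ((n%:R + a + b + 2) * form_coef n (a + 1 + 1) b i +
     n%:R * down_coef n 1 (a + 1 + 1) b i) / (D + 1).
    apply: (divE _ _ _ nDp); have := form_coef_raise (a + 1) i (nzb n).
    have -> : n%:R * down_coef n 1 (a + 1 + 1) b i = n%:R * form_coef n.-1 (a + 1 + 1) b i.
      by case: (n) => [|m]; rewrite ?mul0r // /down_coef subn1.
    by rewrite /D => E; apply: etrans (etrans _ E) _; ring.
  have E3 := down_coef_raise a i (nzb n).
  have {}E3 : n%:R * form_coef n.-1 (a + 1) b i =
      (n%:R * ((n%:R + a + b + 1) * down_coef n 1 (a + 1 + 1) b i +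
          (n%:R - 1) * down_coef n 2 (a + 1 + 1) b i)) / (D - 1).
    apply: (divE _ _ _ nDm); rewrite -E3 /down_coef subn1 /D.
    by case: (n) => [|m] /=; rewrite ?mul0r ?mulr0 ?subn1 //; ring.
  rewrite E1 E2 E3 down_coef0 /bump /=.
  set g0 := form_coef _ _ _ _; set g1 := down_coef _ _ _ _ _; set g2 := down_coef _ _ _ _ _.
  (* with b eliminated, the denominators are D, D + 1, D - 1 for a variable D *)
  have DE : b = D - 2 * n%:R - a - 1 by rewrite /D; ring.
  clearbody D g0 g1 g2; rewrite DE.
  by field; rewrite nD nDp nDm.
- have -> : a + 2 - 2 * 1%:R = a by ring.
  have E1 i' := divE _ _ _ nD (form_coef_raise a i' (nzb n)).
  have {}E1 : upshift (form_coef n a b) i =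
      (n%:R + a + b + 1) / D * upshift (form_coef n (a + 1) b) i +
      1 / D * (n%:R * upshift (down_coef n 1 (a + 1) b) i).
    rewrite (upshift_lin (k := (n%:R + a + b + 1) / D) (l := n%:R / D)
      (v := form_coef n (a + 1) b) (w := form_coef n.-1 (a + 1) b)); last first.
      by move=> i'; rewrite E1; field.
    rewrite /down_coef subn1; congr (_ + _).
    by case: (n) (i) => [|m] [|i'] /=; rewrite ?mul0r ?mulr0 //; ring.
  have E2 : upshift (form_coef n (a + 1) b) i =
     ((n%:R + a + 1) * form_coef n a b i + (n%:R + b + 1) * form_coef n.+1 a b i) / (D + 1).
    apply: (divE _ _ _ nDp); rewrite -form_coef_lower //.
    by rewrite /D; ring.
  have E3 : n%:R * upshift (down_coef n 1 (a + 1) b) i =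
     (n%:R * ((n%:R + a) * down_coef n 1 a b i + (n%:R + b) * form_coef n a b i)) / (D - 1).
    by apply: (divE _ _ _ nDm); rewrite -down_coef_lower // /D; ring.
  rewrite E1 E2 E3 /bump /= addn1 !down_coefS !down_coef0.
  set g0 := form_coef _ _ _ _; set g1 := down_coef _ _ _ _ _; set g2 := form_coef _ _ _ _.
  have DE : b = D - 2 * n%:R - a - 1 by rewrite /D; ring.
  clearbody D g0 g1 g2; rewrite DE.
  by field; rewrite nD nDp nDm.
- have -> : a + 2 - 2 * 2%:R = a - 1 - 1 by ring.
  have low m a' i' : upshift (form_coef m a' b) i' * (2 * m%:R + a' + b + 1) =
     (m%:R + a') * form_coef m (a' - 1) b i' + (m%:R + b + 1) * form_coef m.+1 (a' - 1) b i'.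
    have := form_coef_lower (a' - 1) i' (nzb m.+1); rewrite subrK => E.
    by apply: etrans (etrans _ E) _; ring.
  have E1 : upshift (upshift (form_coef n a b)) i =
      (n%:R + a) / D * upshift (form_coef n (a - 1) b) i +
      (n%:R + b + 1) / D * upshift (form_coef n.+1 (a - 1) b) i.
    apply: upshift_lin => i'.
    have -> := divE _ _ _ nD (etrans (mulrC _ _) (low n a i')).
    by field.
  have E2 : upshift (form_coef n (a - 1) b) i =
    ((n%:R + a - 1) * form_coef n (a - 1 - 1) b i +
     (n%:R + b + 1) * form_coef n.+1 (a - 1 - 1) b i) / (D - 1).
    apply: (divE _ _ _ nDm); rewrite [n%:R + a - 1](_ : _ = n%:R + (a - 1)); last by ring.
    by rewrite -low /D; ring.
  have E3 : upshift (form_coef n.+1 (a - 1) b) i =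
    ((n%:R + a) * form_coef n.+1 (a - 1 - 1) b i +
     (n%:R + b + 2) * form_coef n.+2 (a - 1 - 1) b i) / (D + 1).
    apply: (divE _ _ _ nDp).
    have -> : n%:R + a = n.+1%:R + (a - 1) by rewrite -natr1; ring.
    have -> : n%:R + b + 2 = n.+1%:R + b + 1 by rewrite -natr1; ring.
    by rewrite -low /D -natr1; ring.
  rewrite E1 E2 E3 /bump /= addn2 !down_coefS !down_coef0.
  set g0 := form_coef _ _ _ _; set g1 := form_coef _ _ _ _; set g2 := form_coef _ _ _ _.
  have DE : b = D - 2 * n%:R - a - 1 by rewrite /D; ring.
  clearbody D g0 g1 g2; rewrite DE.
  by field; rewrite nD nDp nDm.
Qed.

End ThreeTerm.

Section Forms.
Variables (R : realType) (A : comAlgType R).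
Implicit Types (a b : R) (n i e f : nat) (X Y : A).

Definition jacobi_form n a b X Y : A :=
  \sum_(i < n.+1) form_coef n a b i *: (X ^+ i * Y ^+ (n - i)).

(** Multiplication by a power of Y does not change the
    coefficients; it brings forms of different degrees to a common degree. *)
Lemma jacobi_form_pad n m a b X Y : (n <= m)%N ->
  Y ^+ (m - n) * jacobi_form n a b X Y =
  \sum_(i < m.+1) form_coef n a b i *: (X ^+ i * Y ^+ (m - i)).
Proof.
move=> le_nm; rewrite mulr_sumr.
rewrite (big_ord_widen_cond m.+1 xpredT
  (fun i => Y ^+ (m - n) * (form_coef n a b i *: (X ^+ i * Y ^+ (n - i))))) //.
rewrite [RHS](bigID (fun i : 'I_m.+1 => (i < n.+1)%N)) /= [X in _ = _ + X]big1 ?addr0.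
  apply: eq_bigr => i; rewrite ltnS => le_in.
  rewrite -scalerAr mulrCA -exprD; congr (_ *: (_ * _ ^+ _)); lia.
by move=> i; rewrite -leqNgt => lt_ni; rewrite form_coef_small // scale0r.
Qed.

Lemma form_mulX n (u : nat -> R) e X Y :
  X ^+ e * (\sum_(i < n.+1) u i *: (X ^+ i * Y ^+ (n - i))) =
  \sum_(i < (n + e).+1) iter e upshift u i *: (X ^+ i * Y ^+ (n + e - i)).
Proof.
elim: e => [|e IH] /=; first by rewrite mul1r addn0.
rewrite exprS -mulrA IH addnS [RHS]big_ord_recl scale0r add0r mulr_sumr.
by apply: eq_bigr => i _; rewrite -scalerAr mulrA -exprS.
Qed.

Lemma jacobi_form_three_term n a b e X Y :
  (forall m, poch (b + 1) m != 0) -> (e < 3)%N ->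
  2 * n%:R + a + b + 1 != 0 ->
  2 * n%:R + a + b + 1 + 1 != 0 ->
  2 * n%:R + a + b + 1 - 1 != 0 ->
  X ^+ e * jacobi_form n a b X Y =
  \sum_(f < 3) trans_coef n a b e f *:
    (if (f <= n + e)%N
     then Y ^+ f * jacobi_form (n + e - f) (a + 2 - 2 * e%:R) b X Y else 0).
Proof.
move=> nzb lt_e nD nDp nDm; rewrite form_mulX //.
under eq_bigr do rewrite form_coef_three_term // scaler_suml.
rewrite exchange_big; apply: eq_bigr => f _ /=.
under eq_bigr do rewrite -scalerA.
rewrite -scaler_sumr; congr (_ *: _).
case: ifP => le_f; last first.
  by rewrite big1 // => i _; rewrite /down_coef le_f scale0r.
have := @jacobi_form_pad _ (n + e) (a + 2 - 2 * e%:R) b X Y (leq_subr f (n + e)).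
rewrite subKn // => ->; apply: eq_bigr => i _; by rewrite /down_coef le_f.
Qed.

End Forms.

(** * The factors of the multivariable Jacobi polynomials *)

Section Factors.
Variables (R : realType) (p : nat) (gamma : 'I_p.+1 -> R).

Lemma at1E (V : nmodType) m (v : 'I_m -> V) (i : 'I_m) : at1 v i.+1 = v i.
Proof.
rewrite /at1 (bigD1 i) //= big1 ?addr0 // => k /andP[/eqP[E] /eqP]; case.
exact: val_inj.
Qed.

Lemma psumS (V : nmodType) m (v : 'I_m -> V) k :
  psum v k.+1 = psum v k + at1 v k.+1.
Proof.
rewrite /psum /at1 (bigID (fun i : 'I_m => (i < k)%N)) /=; congr (_ + _).
  by apply: eq_bigl => i; rewrite ltnS andbC; case: ltnP => // /ltnW ->.
by apply: eq_bigl => i; rewrite ltnS -leqNgt -eqn_leq eqSS.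
Qed.

Lemma psum0 (V : nmodType) m (v : 'I_m -> V) : psum v 0 = 0.
Proof. by rewrite /psum big_pred0. Qed.

(** The k-th factor of J_p with its share of the sign, for N_1^{k-1} = N
    and n_k = m. *)
Definition factor (k N m : nat) : mpol R p :=
  jacobi_form m (2 * N%:R + psum gamma k + k%:R - 1) (at1 gamma k.+1)
    (Zsum R p k) (Zsum R p k.+1).

Hypothesis hgamma : Jpoly_defined gamma.

Lemma poch_at1_neq0 (k m : nat) : (1 <= k <= p)%N ->
  poch (at1 gamma k.+1 + 1) m != 0.
Proof.
move=> hk; have [] := hgamma (fun=> m) hk.
case: k hk => // k /andP[_ lt_kp]; by rewrite (at1E _ (Ordinal lt_kp)).
Qed.

Lemma sum_at1 (V : nmodType) m (v : 'I_m -> V) :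
  \sum_(i < m) v i = \sum_(1 <= k < m.+1) at1 v k.
Proof.
rewrite big_add1 /= big_mkord; apply: eq_bigr => i _; by rewrite at1E.
Qed.

Lemma Jpoly_factor (n : 'I_p -> nat) :
  Jpoly gamma n =
  \prod_(1 <= k < p.+1) factor k (psum n k.-1) (at1 n k).
Proof.
rewrite /Jpoly.
have -> : (-1) ^+ (\sum_(i < p) n i)%N =
    \prod_(1 <= k < p.+1) (-1) ^+ at1 n k :> mpol R p.
  by rewrite -expr_sum; congr (_ ^+ _); exact: (sum_at1 n).
rewrite -big_split /= !big_nat; apply: eq_bigr => k hk.
have [nz1 nz2] := hgamma n hk.
rewrite /factor /jacobi_form /homog scaler_sumr mulr_sumr.
apply: eq_bigr => i _; rewrite scalerA -form_coef_jacobi //; last first.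
  by rewrite -ltnS.
rewrite -!(signr_odd _ (at1 n k)).
by case: odd; rewrite ?expr1 ?expr0 ?mul1r // !mulN1r scaleNr.
Qed.

End Factors.

(** * Euler and Bessel operators *)

Section DifferentialOperators.
Variables (R : realType) (p : nat) (gamma : 'I_p.+1 -> R).
Implicit Types (f g W : mpol R p) (M N k j r : nat) (i l : 'I_p).

Definition euler M f : mpol R p := \sum_(i < p | (i < M)%N) mvar R i * 'd_i f.

(** A homogeneous U with bessel M U = 0 is called harmonic below: this
    operator plays the role of the Laplacian. *)
Definition bessel M f : mpol R p :=
  \sum_(i < p | (i < M)%N)
    (mvar R i * 'd_i ('d_i f) + (at1 gamma i.+1 + 1) *: 'd_i f).

Lemma mderiv_mvar i l : 'd_i (mvar R l) = (l == i)%:R.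
Proof.
rewrite mderivX mnm1E; case: eqP => [->|_]; last by rewrite scale0r.
rewrite scale1r -mpolyX0; congr mpolyX; apply/mnmP => k.
by rewrite mnmBE subnn mnm0E.
Qed.

Fact euler_is_linear M : linear (euler M).
Proof.
move=> c f g; rewrite /euler scaler_sumr -big_split; apply: eq_bigr => i _ /=.
by rewrite mderivD mderivZ mulrDr -scalerAr.
Qed.
HB.instance Definition _ M :=
  GRing.isLinear.Build R (mpol R p) (mpol R p) _ (euler M) (euler_is_linear M).

Fact bessel_is_linear M : linear (bessel M).
Proof.
move=> c f g; rewrite /bessel scaler_sumr -big_split; apply: eq_bigr => i _ /=.
rewrite !mderivD !mderivZ mulrDr scalerDr -scalerAr scalerDr !scalerA [_ * c]mulrC.
by rewrite addrACA.
Qed.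
HB.instance Definition _ M :=
  GRing.isLinear.Build R (mpol R p) (mpol R p) _ (bessel M) (bessel_is_linear M).

Lemma eulerM M f g : euler M (f * g) = f * euler M g + euler M f * g.
Proof.
rewrite /euler mulr_suml mulr_sumr -big_split; apply: eq_bigr => i _ /=.
by rewrite mderivM; ring.
Qed.

Lemma sum_sym (P : pred 'I_p) (a : 'I_p -> 'I_p -> mpol R p) :
  (forall i l, a i l = a l i) ->
  \sum_(i | P i) \sum_(l | P l) a i l =
  \sum_(i | P i) a i i + 2 *: (\sum_(i | P i) \sum_(l < p | (i < l)%N && P l) a i l).
Proof.
move=> a_sym.
have lt_gt : \sum_(i | P i) \sum_(l < p | (l < i)%N && P l) a i l =
    \sum_(i | P i) \sum_(l < p | (i < l)%N && P l) a i l.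
  rewrite (exchange_big_dep P) /=; last by move=> ? ? _ /andP[].
  apply: eq_bigr => i Pi; apply: eq_big => [l|l _]; last exact: a_sym.
  by rewrite Pi andbT andbC.
rewrite scaler_nat mulr2n -{1}lt_gt -!big_split; apply: eq_bigr => i Pi /=.
rewrite (bigD1 i Pi) /=; congr (_ + _).
rewrite (bigID (fun l : 'I_p => (l < i)%N)) /=; congr (_ + _); apply: eq_bigl => l.
  by rewrite -val_eqE /= andbC; case: ltngtP; rewrite ?andbF ?andbT.
by rewrite -val_eqE /= -leqNgt andbC; case: ltngtP; rewrite ?andbF ?andbT.
Qed.

Lemma euler2 M f :
  euler M (euler M f) = euler M f +
    \sum_(i < p | (i < M)%N) \sum_(l < p | (l < M)%N)
      mvar R i * mvar R l * 'd_i ('d_l f).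
Proof.
rewrite {1}/euler; under eq_bigr => i lt_i.
  rewrite raddf_sum /= mulr_sumr.
  under eq_bigr => l _ do rewrite mderivM mderiv_mvar mulrDr mulrA.
  rewrite big_split /= (bigD1 i) //= eqxx mul1r big1 ?addr0; last first.
    by move=> l /andP[_ /negbTE->]; rewrite mul0r mulr0.
  over.
by rewrite big_split.
Qed.

(** The coefficients - z_l z_m (also for l = m) of the second-order
    part make up - (E^2 - E), E the Euler operator, and the remaining
    second-order part is Z_1^{j+1} times that of the Bessel operator. *)
Lemma Lz_bessel j f : (j <= p)%N ->
  let M := minn j.+1 p in
  Lz gamma j f = Zsum R p j.+1 * bessel M f
    - (euler M (euler M f) + (psum gamma j.+1 + j%:R) *: euler M f).
Proof.
move=> le_jp M; rewrite euler2 sum_sym; last first.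
  by move=> i l; rewrite mderiv_comm [mvar R i * _]mulrC.
rewrite /Lz -/M.
have -> : \sum_(i < p) \sum_(m < p | (i < m < M)%N) mvar R i * mvar R m * 'd_i ('d_m f)
  = \sum_(i < p | (i < M)%N) \sum_(m < p | (i < m < M)%N) mvar R i * mvar R m * 'd_i ('d_m f).
  rewrite [LHS](bigID (fun i : 'I_p => (i < M)%N)) /= [X in _ + X]big1 ?addr0 //.
  move=> i leMi; rewrite big1 // => m /andP[lt_im lt_mM].
  by rewrite (ltn_trans lt_im lt_mM) in leMi.
move: (\sum_(i < p | _) \sum_(m < p | _) _) => S.
rewrite scaleNr -addrA /bessel /euler mulr_sumr !scaler_sumr.
rewrite !opprD !addrA.
rewrite [RHS](_ : _ = - (2 *: S) + (\sum_(i < p | (i < M)%N)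
  (Zsum R p j.+1 * (mvar R i * 'd_i ('d_i f) + (at1 gamma i.+1 + 1) *: 'd_i f))
  - \sum_(i < p | (i < M)%N) mvar R i * 'd_i f
  - \sum_(i < p | (i < M)%N) mvar R i * mvar R i * 'd_i ('d_i f)
  - \sum_(i < p | (i < M)%N) (psum gamma j.+1 + j%:R) *: (mvar R i * 'd_i f))); last first.
  by ring.
rewrite -addrA; congr (_ + _); rewrite -!sumrN -!big_split; apply: eq_bigr => i _ /=.
by rewrite -!mul_mpolyC -natr1 !mpolyCD; ring.
Qed.

End DifferentialOperators.

(** * Harmonic polynomials and eigenfunctions in z *)

Section Spectral.
Variables (R : realType) (p : nat) (gamma : 'I_p.+1 -> R).
Implicit Types (f g W U : mpol R p) (M N k j r : nat) (i l : 'I_p).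

Notation euler := (@euler R p).
Notation bessel := (bessel gamma).

(** The operator L_j differentiates in z_1, ..., z_{j+1} only, and this
    is all it can see of Z_1^k for k > j. *)
Definition unit_gradient M W := forall i, (i < M)%N -> 'd_i W = 1.

Lemma unit_gradient_Zsum k M :
  (M <= k <= p)%N -> unit_gradient M (Zsum R p k).
Proof.
move=> /andP[le_Mk le_kp] i /leq_trans /(_ le_Mk) lt_ik.
rewrite /Zsum le_kp /psum raddf_sum /= (bigD1 i) //=.
rewrite mderiv_mvar eqxx big1 ?addr0 // => l /andP[_ /negbTE ne_li].
by rewrite mderiv_mvar ne_li.
Qed.

Lemma psum_ord (V : nmodType) m (v : 'I_m -> V) k :
  psum v k = \sum_(i < k) at1 v i.+1.
Proof.
elim: k => [|k IH]; first by rewrite psum0 big_ord0.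
by rewrite psumS big_ord_recr IH.
Qed.

Lemma euler_unit M W f : (M <= p)%N -> unit_gradient M W ->
  euler M (W * f) = W * euler M f + Zsum R p M * f.
Proof.
move=> le_Mp gW; rewrite eulerM; congr (_ + _ * _).
by rewrite /Zsum le_Mp; apply: eq_bigr => i lt_i; rewrite gW ?mulr1.
Qed.

Lemma bessel_unit M W f : (M <= p)%N -> unit_gradient M W ->
  bessel M (W * f) = W * bessel M f + 2 *: euler M f
    + (psum gamma M + M%:R) *: f.
Proof.
move=> le_Mp gW.
have -> : psum gamma M + M%:R = \sum_(i < p | (i < M)%N) (at1 gamma i.+1 + 1).
  rewrite -(big_ord_widen _ (fun r : nat => at1 gamma r.+1 + 1) le_Mp) big_split /=.
  by rewrite psum_ord sumr_const card_ord.
rewrite scaler_suml scaler_sumr mulr_sumr -!big_split /=; apply: eq_bigr => i lt_i.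
rewrite !mderivM !mderivD !mderivM gW //.
have -> : 'd_i 1 = 0 :> mpol R p by rewrite -[1]/(mpolyC p 1) mderivC.
by rewrite -!mul_mpolyC !mpolyCD; ring.
Qed.

Lemma Lz_linear j : (j <= p)%N -> linear (Lz gamma j).
Proof.
move=> le_jp c f g; rewrite !Lz_bessel // !linearP /=.
by rewrite -!mul_mpolyC !mpolyCD; ring.
Qed.

Lemma Lz_lin_sum j n (c : 'I_n -> R) (F : 'I_n -> mpol R p) : (j <= p)%N ->
  Lz gamma j (\sum_t c t *: F t) = \sum_t c t *: Lz gamma j (F t).
Proof.
move=> /Lz_linear Lj.
have L0 : Lz gamma j 0 = 0.
  by have := Lj (-1) 0 0; rewrite scaler0 addr0 scaleN1r addNr.
elim/big_rec2: _ => // t x y _ <-; exact: Lj.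
Qed.

(** Applied to W f, with W of gradient 1, the terms of Y B and of
    E (E + c) in which W is differentiated are the same and cancel.  This
    removes from J_p the factors with index above j. *)
Lemma Lz_Zsum j k f : (0 < j <= p)%N -> (j < k)%N ->
  Lz gamma j (Zsum R p k * f) = Zsum R p k * Lz gamma j f.
Proof.
move=> /andP[_ le_jp] lt_jk; have [le_kp|lt_pk] := leqP k p; last first.
  by rewrite /Zsum leqNgt lt_pk !mul1r.
have lt_jp : (j < p)%N by apply: leq_trans lt_jk le_kp.
rewrite !Lz_bessel // (minn_idPl lt_jp).
have gW : unit_gradient j.+1 (Zsum R p k) by apply: unit_gradient_Zsum; rewrite lt_jk.
have gY : unit_gradient j.+1 (Zsum R p j.+1).
  by apply: unit_gradient_Zsum; rewrite leqnn.
rewrite bessel_unit // [euler _ (Zsum _ _ _ * f)]euler_unit // [euler _ (_ + _)]linearD /=.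
rewrite !euler_unit // -natr1.
by rewrite -!mul_mpolyC !mpolyCD; ring.
Qed.

Lemma Lz_ZsumX j M f r : (0 < j <= p)%N -> (j < M)%N ->
  Lz gamma j (Zsum R p M ^+ r * f) = Zsum R p M ^+ r * Lz gamma j f.
Proof.
move=> hj lt_jl; elim: r => [|r IH]; first by rewrite !mul1r.
by rewrite exprS -!mulrA Lz_Zsum // IH.
Qed.

Definition depends_on k f := forall i, (k <= i)%N -> 'd_i f = 0.

Lemma depends_onM k f g :
  depends_on k f -> depends_on k g -> depends_on k (f * g).
Proof. by move=> kf kg i ki; rewrite mderivM kf ?kg // mulr0 mul0r addr0. Qed.

Lemma depends_onX k f r : depends_on k f -> depends_on k (f ^+ r).
Proof.
move=> kf; elim: r => [|r IH] i ki; last by rewrite exprS (depends_onM kf IH).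
by rewrite expr0 -mpolyC1 mderivC.
Qed.

Lemma depends_on_Zsum k M : (k <= M)%N -> (k <= p)%N -> depends_on M (Zsum R p k).
Proof.
move=> le_kM le_kp i le_Mi; rewrite /Zsum le_kp raddf_sum /= big1 // => l lt_lk.
rewrite mderiv_mvar; case: eqP => // eli; move: lt_lk.
by rewrite eli ltnNge (leq_trans le_kM).
Qed.

Lemma depends_on_sum k n (F : 'I_n -> mpol R p) :
  (forall t, depends_on k (F t)) -> depends_on k (\sum_t F t).
Proof. by move=> kF i ki; rewrite raddf_sum /= big1 // => t _; rewrite kF. Qed.

Lemma depends_onZ k (c : R) f : depends_on k f -> depends_on k (c *: f).
Proof. by move=> kf i ki; rewrite mderivZ kf ?scaler0. Qed.

Lemma sum_lt_depends k M (F : 'I_p -> mpol R p) : (k <= M)%N ->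
  (forall i, (k <= i)%N -> F i = 0) ->
  \sum_(i < p | (i < M)%N) F i = \sum_(i < p | (i < k)%N) F i.
Proof.
move=> le_kM F0; rewrite (bigID (fun i : 'I_p => (i < k)%N)) /=.
rewrite [X in _ + X]big1 ?addr0; last first.
  by move=> i /andP[_]; rewrite -leqNgt => /F0.
apply: eq_bigl => i; case: (ltnP i k) => [lt_ik|]; last by rewrite andbF.
by rewrite (leq_trans lt_ik).
Qed.

Lemma euler_depends k M f : (k <= M)%N -> depends_on k f ->
  euler M f = euler k f.
Proof. by move=> kM kf; apply: sum_lt_depends => // i ki; rewrite kf ?mulr0. Qed.

Lemma bessel_depends k M f : (k <= M)%N -> depends_on k f ->
  bessel M f = bessel k f.
Proof.
move=> kM kf; apply: sum_lt_depends => // i ki.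
by rewrite kf // raddf0 mulr0 scaler0 addr0.
Qed.

Section Harmonic.
Variables (k N : nat) (U : mpol R p).
Hypothesis hk : (0 < k <= p)%N.
Hypotheses (Udep : depends_on k U) (Uhom : euler k U = N%:R *: U)
  (Uharm : bessel k U = 0).

Let X := Zsum R p k.
Let gX : unit_gradient k X.
Proof. by apply: unit_gradient_Zsum; rewrite leqnn; case/andP: hk. Qed.
Let lekp : (k <= p)%N. Proof. by case/andP: hk. Qed.

Lemma euler_harmonic r : euler k (X ^+ r * U) = (N + r)%:R *: (X ^+ r * U).
Proof.
elim: r => [|r IH]; first by rewrite mul1r addn0.
rewrite exprS -mulrA euler_unit // IH addnS -!mul_mpolyC -natr1 mpolyCD.
by rewrite -/X; ring.
Qed.

(** By Euler's identity the mixed term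
    2 sum_i z_i d_i(X^r) d_i(U) is 2 r N X^(r-1) U: this is how the degree of
    the lower factors enters the first parameter of a Jacobi factor. *)
Lemma bessel_harmonic r :
  bessel k (X ^+ r * U) =
  (r%:R * (r%:R + (2 * N%:R + psum gamma k + k%:R - 1))) *: (X ^+ r.-1 * U).
Proof.
elim: r => [|r IH]; first by rewrite mul1r mul0r scale0r.
rewrite exprS -mulrA bessel_unit // IH euler_harmonic natrD.
have -> : X * ((r%:R * (r%:R + (2 * N%:R + psum gamma k + k%:R - 1))) *:
    (X ^+ r.-1 * U)) =
   (r%:R * (r%:R + (2 * N%:R + psum gamma k + k%:R - 1))) *: (X ^+ r * U).
  case: (r) => [|s]; first by rewrite !mul0r !scale0r mulr0.
  by rewrite -scalerAr mulrA -exprS.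
rewrite scalerA -!scalerDl -natr1; congr (_ *: _); ring.
Qed.

Definition Lz_eigen r : R := - ((N + r)%:R * ((N + r)%:R + k%:R + psum gamma k.+1)).

Lemma Lz_monomial r :
  Lz gamma k (X ^+ r * U) =
  (r%:R * (r%:R + (2 * N%:R + psum gamma k + k%:R - 1))) *:
    (Zsum R p k.+1 * (X ^+ r.-1 * U)) + Lz_eigen r *: (X ^+ r * U).
Proof.
have dep : depends_on k (X ^+ r * U).
  by apply: depends_onM => //; apply: depends_onX; apply: depends_on_Zsum.
rewrite Lz_bessel //; set M := minn _ _.
have kM : (k <= M)%N by rewrite leq_min leqnSn.
have eU : euler M (X ^+ r * U) = (N + r)%:R *: (X ^+ r * U).
  by rewrite (euler_depends kM) // euler_harmonic.
rewrite eU linearZ /= eU (bessel_depends kM) // bessel_harmonic.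
rewrite /Lz_eigen -!mul_mpolyC !rmorphM !rmorphN !rmorphD /=.
by rewrite !rmorphM; ring.
Qed.

(** The operator maps X^i U to a combination of Y X^(i-1) U and
    X^i U.  By the recurrence of the hypergeometric coefficients the
    contribution of X^(i+1) U turns into one to X^i U, and
    (i-m)(i+m+2N+c) - (N+i)(N+i+c) = - (N+m)(N+m+c) does not depend on i. *)
Lemma Lz_factor m :
  Lz gamma k (factor gamma k N m * U) = Lz_eigen m *: (factor gamma k N m * U).
Proof.
rewrite /factor /jacobi_form mulr_suml.
under eq_bigr do rewrite -scalerAl.
rewrite Lz_lin_sum // scaler_sumr -/X.
set a := 2 * N%:R + psum gamma k + k%:R - 1; set b := at1 gamma k.+1.
set Y := Zsum R p k.+1.
have term (i : nat) : form_coef m a b i *: Lz gamma k (X ^+ i * Y ^+ (m - i) * U) =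
    (form_coef m a b i * (i%:R * (i%:R + a))) *:
      (Y ^+ (m - i).+1 * (X ^+ i.-1 * U))
    + (form_coef m a b i * Lz_eigen i) *: (X ^+ i * Y ^+ (m - i) * U).
  rewrite [X ^+ i * _]mulrC -mulrA Lz_ZsumX // Lz_monomial -/Y.
  rewrite mulrDr scalerDr -!scalerAr !scalerA exprSr.
  by congr (_ *: _ + _ *: _); ring.
under eq_bigr do rewrite term.
rewrite big_split /= big_ord_recl /= !mul0r mulr0 scale0r add0r.
have -> : \sum_(i < m)
    (form_coef m a b i.+1 * (i.+1%:R * (i.+1%:R + a))) *:
      (Y ^+ (m - i.+1).+1 * (X ^+ i * U)) =
    \sum_(i < m.+1) ((i%:R - m%:R) * (i%:R + m%:R + a + b + 1) * form_coef m a b i)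
     *: (X ^+ i * Y ^+ (m - i) * U).
  rewrite [RHS]big_ord_recr /= subrr !mul0r scale0r addr0.
  apply: eq_bigr => i _; rewrite -form_coef_hypergeometric subnSK // -natr1.
  rewrite mulrCA mulrA; congr (_ *: _); ring.
rewrite -big_split; apply: eq_bigr => i _ /=.
rewrite -scalerDl scalerA; congr (_ *: _).
rewrite /Lz_eigen !natrD psumS -/b /a; ring.
Qed.

End Harmonic.

End Spectral.

(** * The differential equation *)

Section FirstEquation.
Variables (R : realType) (p : nat) (gamma : 'I_p.+1 -> R).
Implicit Types (f U : mpol R p) (M N k j r m : nat).

Lemma euler_ZsumX M k r : (k <= M)%N -> (k <= p)%N ->
  euler M (Zsum R p k ^+ r) = r%:R *: Zsum R p k ^+ r.
Proof.
move=> kM kp; elim: r => [|r IH].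
  rewrite scale0r /euler big1 // => i _.
  by rewrite expr0 -mpolyC1 mderivC mulr0.
have E1 : euler M (Zsum R p k) = Zsum R p k.
  rewrite (euler_depends kM); last exact: depends_on_Zsum.
  rewrite -[X in euler k X]mulr1 euler_unit //; last first.
    by apply: unit_gradient_Zsum; rewrite leqnn.
  rewrite /euler big1 ?mulr0 ?add0r ?mulr1 // => i _.
  by rewrite -mpolyC1 mderivC mulr0.
by rewrite exprS eulerM IH E1 -!mul_mpolyC -natr1 mpolyCD; ring.
Qed.

Lemma euler_factor M k N m U (c : R) : (k < M)%N -> (k < p)%N ->
  euler M U = c *: U ->
  euler M (factor gamma k N m * U) = (c + m%:R) *: (factor gamma k N m * U).
Proof.
move=> kM kp EU; rewrite eulerM EU -scalerAr scalerDl; congr (_ + _).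
rewrite scalerAl; congr (_ * _); rewrite /factor /jacobi_form raddf_sum /= scaler_sumr.
apply: eq_bigr => i _; rewrite linearZ /= eulerM !euler_ZsumX // ?(ltnW kp) ?(ltnW kM) //.
rewrite -scalerAr -scalerAl -scalerDl -natrD subnK; last by rewrite -ltnS.
by rewrite !scalerA mulrC.
Qed.

Lemma depends_on_factor k N m : (k < p)%N ->
  depends_on k.+1 (factor gamma k N m).
Proof.
move=> lt_kp; apply: depends_on_sum => i; apply: depends_onZ.
by apply: depends_onM; apply: depends_onX; apply: depends_on_Zsum; rewrite // ltnW.
Qed.

Lemma Zsum_neq0 k : (0 < k <= p)%N -> Zsum R p k != 0.
Proof.
move=> /andP[k0 kp]; apply/eqP => Z0.
have g : unit_gradient k (Zsum R p k) by apply: unit_gradient_Zsum; rewrite leqnn.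
have := g (Ordinal (leq_trans k0 kp)) k0.
by rewrite Z0 mderiv0 => /esym/eqP; rewrite oner_eq0.
Qed.

Definition factor_prod (n : 'I_p -> nat) a b :=
  \prod_(a <= k < b) factor gamma k (psum n k.-1) (at1 n k).

(** Harmonicity passes from one product to the next: if U is
    homogeneous of degree d and an eigenfunction of Y B - E (E + c) with the
    eigenvalue - d (d + c), then Y B U = 0. *)
Lemma harmonic_factor_prod (n : 'I_p -> nat) k : (k < p)%N ->
  let U := factor_prod n 1 k.+1 in
  [/\ depends_on k.+1 U, euler k.+1 U = (psum n k)%:R *: U & bessel gamma k.+1 U = 0].
Proof.
elim: k => [|k IH] lt_kp /=.
  rewrite /factor_prod big_geq // psum0 scale0r.
  have d1 i : 'd_i (1 : mpol R p) = 0 by rewrite -mpolyC1 mderivC.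
  split=> [i _||]; first exact: d1.
    by rewrite /euler big1 // => i _; rewrite d1 mulr0.
  by rewrite /bessel big1 // => i _; rewrite d1 mderiv0 mulr0 scaler0 addr0.
have [Udep Ueul Ubes] := IH (ltnW lt_kp).
have -> : factor_prod n 1 k.+2 =
    factor gamma k.+1 (psum n k) (at1 n k.+1) * factor_prod n 1 k.+1.
  by rewrite /factor_prod big_nat_recr //= mulrC.
set U := factor_prod n 1 k.+1 in Udep Ueul Ubes *.
set F := factor _ _ _ _.
have dep : depends_on k.+2 (F * U).
  apply: depends_onM; first exact: depends_on_factor.
  by move=> i lt_i; apply: Udep; apply: ltnW.
have eul : euler k.+2 (F * U) = (psum n k.+1)%:R *: (F * U).
  rewrite psumS natrD; apply: euler_factor => //.
  by rewrite (euler_depends (leqnSn k.+1)).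
split=> //.
have : Lz gamma k.+1 (F * U) =
    Lz_eigen gamma k.+1 (psum n k) (at1 n k.+1) *: (F * U).
  by apply: Lz_factor => //; rewrite /= ltnW.
rewrite Lz_bessel ?(ltnW lt_kp) // (minn_idPl lt_kp) eul linearZ /= eul.
rewrite /Lz_eigen psumS => E.
(* the two terms of the operator without Z_1^{k+2} B cancel *)
apply: (mulfI (Zsum_neq0 (k := k.+2) _)); first by rewrite /= lt_kp.
move/eqP: E; rewrite subr_eq mulr0 => /eqP->.
by rewrite -!mul_mpolyC !(natrD, mpolyCD, rmorphM, rmorphN) /= !rmorphD /=; ring.
Qed.

Lemma Lz_factor_prod (n : 'I_p -> nat) j a b f : (0 < j <= p)%N -> (j < a)%N ->
  Lz gamma j (factor_prod n a b * f) = factor_prod n a b * Lz gamma j f.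
Proof.
move=> hj lt_ja; have le_jp : (j <= p)%N by case/andP: hj.
have [le_ab|lt_ba] := leqP a b; last first.
  by rewrite /factor_prod big_geq ?(ltnW lt_ba) // !mul1r.
rewrite -(subnKC le_ab); elim: (b - a)%N f => [|d IH] f.
  by rewrite addn0 /factor_prod big_geq // !mul1r.
rewrite addnS /factor_prod big_nat_recr ?leq_addr //= -!mulrA IH.
congr (_ * _); rewrite /factor /jacobi_form !mulr_suml.
under eq_bigr do rewrite -scalerAl.
rewrite Lz_lin_sum //; apply: eq_bigr => i _; rewrite -scalerAl; congr (_ *: _).
by rewrite -!mulrA !Lz_ZsumX // ?(leq_trans lt_ja) // ?leqW // leq_addr.
Qed.

Lemma Lz_Jpoly (n : 'I_p -> nat) j : Jpoly_defined gamma -> (0 < j <= p)%N ->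
  Lz gamma j (Jpoly gamma n) = mu_hat gamma n j *: Jpoly gamma n.
Proof.
move=> hgamma hj; rewrite Jpoly_factor // -/(factor_prod n 1 p.+1).
case: j hj => // j hj.
have -> : factor_prod n 1 p.+1 = factor_prod n j.+2 p.+1 *
    (factor gamma j.+1 (psum n j) (at1 n j.+1) * factor_prod n 1 j.+1).
  rewrite /factor_prod (@big_cat_nat _ _ _ j.+2) //= mulrC; congr (_ * _).
  by rewrite big_nat_recr //= mulrC.
have [Udep Ueul Ubes] := harmonic_factor_prod n hj.
rewrite Lz_factor_prod // Lz_factor // -scalerAr; congr (_ *: _).
by rewrite /Lz_eigen /mu_hat (psumS n).
Qed.

End FirstEquation.

(** * Chain sums *)

Section ChainSums.
Variables (R : realType) (p : nat) (gamma : 'I_p.+1 -> R) (n : 'I_p -> nat).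

(** Under the isomorphism and with beta_k = beta_0 + gamma_1^k + k, the site
    x_{i+1} (i = 0, ..., j-1) corresponds to the level k = p - i, that is to
    the factor k of J_p: x_{i+1} becomes S + G + N and x_{i+1} + beta_{i+1}
    becomes S - N, for S = N_1^k and G = gamma_1^{k+1} + k.  The reflection
    x -> - x - beta replaces S by - S - G. *)
Definition Slev k : R := (psum n k)%:R.
Definition Glev k : R := psum gamma k.+1 + k%:R.

(** The value of x + beta + N at a site, reflected if eps is true; below,
    tau is that of x - N. *)
Definition sigma k (eps : bool) : R := if eps then - Slev k - Glev k else Slev k.
Definition tau k (eps : bool) : R := sigma k eps + Glev k.

Lemma tauE k eps : tau k eps = if eps then - Slev k else Slev k + Glev k.
Proof. by rewrite /tau /sigma; case: eps; rewrite ?subrK. Qed.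

Lemma sigma_sub_tau k eps : sigma k eps - tau k eps = - Glev k.
Proof. by rewrite /tau; ring. Qed.

(** The factor (2x + beta)(2x + beta + 1) of the denominators. *)
Definition site_den k (eps : bool) : R :=
  (sigma k eps + tau k eps) * (sigma k eps + tau k eps + 1).

(** The factor (x + x' + beta)(x + x' + beta + 1) that links the site at
    level k to the preceding site of a chain, as a function of the tau of the
    latter. *)
Definition site_quad k (eps : bool) (x : R) : R := (x + sigma k eps) * (x + sigma k eps + 1).

(** The three quadratic polynomials left behind by a site: for e = 0, 2
    they are its linking factors, and e = 1 describes an unshifted site. *)
Definition level_quad k e (x : R) : R := quad e (x + Slev k) (x - Slev k - Glev k).

Definition site_shift (m : nat) : multishift p :=
  unit_shift p (p - m) - unit_shift p (p - m).+1.

Definition signed_shift m (eps : bool) : multishift p :=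
  if eps then - site_shift m else site_shift m.

Variables (V : lmodType R) (Phi : multishift p -> V).

(** The sum over the sites m-1, ..., 0, once the larger sites have been
    treated.  These are recorded by a quadratic polynomial q (in the tau of
    the next site that enters the chain, with leading coefficient a) and by
    the shift s.  Either the site m-1 stays out of the chain, or it enters
    with a sign eps, and then a difference operator acts and q is replaced by
    the linking factor of the site.  At the end only the leading coefficient of q
    is kept: this is the effect of beta_0 and N tending to infinity. *)
Fixpoint chain_sum m (a : R) (q : R -> R) (s : multishift p) : V :=
  if m is m'.+1 then
    chain_sum m' a q s +
    \sum_(eps : bool) (q (tau (p - m') eps) / site_den (p - m') eps) *:
      (chain_sum m' 1 (site_quad (p - m') eps) (s + signed_shift m' eps)
       - chain_sum m' 1 (site_quad (p - m') eps) s)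
  else a *: Phi s.

Lemma chain_sum_linear m r (c a : 'I_r -> R) (q : 'I_r -> R -> R) a0 q0 s :
  a0 = \sum_i c i * a i -> (forall x, q0 x = \sum_i c i * q i x) ->
  chain_sum m a0 q0 s = \sum_i c i *: chain_sum m (a i) (q i) s.
Proof.
move=> a0E q0E; elim: m => [|m IH] /=.
  by rewrite a0E scaler_suml; apply: eq_bigr => i _; rewrite scalerA.
rewrite IH; under [RHS]eq_bigr do rewrite scalerDr scaler_sumr.
rewrite [RHS]big_split /= exchange_big /=; congr (_ + _).
apply: eq_bigr => eps _; rewrite q0E mulr_suml scaler_suml.
by apply: eq_bigr => i _; rewrite scalerA mulrA.
Qed.

Lemma level_quad_site k x : (level_quad k 0 x = site_quad k false x) * (level_quad k 2 x = site_quad k true x).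
Proof. by rewrite /level_quad /site_quad /= addrA. Qed.

(** Let S' and G' belong to the level k-1.  Then S = S' + n_k,
    G = G' + b + 1 and a = 2S' + G', so that the two arguments of quad are
    the same in the weights of a site and in those of the three-term relation
    of the factor k. *)
Lemma trans_coef_level k e : (0 < k)%N ->
  let N := psum n k.-1 in
  let a := 2 * N%:R + psum gamma k + k%:R - 1 in
  let b := at1 gamma k.+1 in
  [/\ 2 * Slev k + Glev k = 2 * (at1 n k)%:R + a + b + 1,
   level_quad k.-1 e (tau k false) / site_den k false = trans_plus (at1 n k) a b e &
   level_quad k.-1 e (tau k true) / site_den k true = trans_minus (at1 n k) a b e].
Proof.
case: k => // k _ N a b; rewrite succnK in N a *.
have SE : Slev k.+1 = Slev k + (at1 n k.+1)%:R by rewrite /Slev psumS natrD.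
have GE : Glev k.+1 = Glev k + b + 1.
  by rewrite /Glev psumS -natr1 /b; ring.
have aE : a = 2 * Slev k + Glev k.
  by rewrite /a /N /Slev /Glev -natr1; ring.
split; first by rewrite SE GE aE; ring.
  rewrite /trans_plus /level_quad /site_den /tau /sigma SE GE aE.
  by congr (quad e _ _ / _); ring.
rewrite /trans_minus /level_quad /site_den /tau /sigma SE GE aE.
by congr (quad e _ _ / _); ring.
Qed.

(** The polynomial with e = 0 vanishes at tau = - S, the one
    with e = 2 at tau = S + G, and the one with e = 1 at both points.  The
    values at these two points give the outer weights, and the leading
    coefficients give the middle one. *)
Lemma level_quad_decomp k e x :
  (e < 3)%N ->
  let D := 2 * Slev k + Glev k in
  D != 0 -> D + 1 != 0 -> D - 1 != 0 ->
  forall k',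
  let tp := level_quad k' e (tau k false) / site_den k false in
  let tm := level_quad k' e (tau k true) / site_den k true in
  level_quad k' e x =
  tp * level_quad k 0 x + (1 - tp - tm) * level_quad k 1 x + tm * level_quad k 2 x.
Proof.
move=> lt_e D nD nDp nDm k' tp tm.
have denE eps : site_den k eps = D * (if eps then D - 1 else D + 1).
  by rewrite /site_den /tau /sigma /D; case: eps; ring.
rewrite /tp /tm !denE /tau /sigma /level_quad.
have GE : Glev k = D - 2 * Slev k by rewrite /D; ring.
rewrite GE; clearbody D.
by case: e lt_e {tp tm} => [|[|[|//]]] _ /=; field; rewrite nD nDp nDm.
Qed.

(** A site that is skipped contributes q without a shift, and the
    summands - 1 of the difference operators remove from q its components
    along the linking factors.  What remains unshifted is the component along
    the middle quadratic polynomial: the sum over subsets of sites with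
    difference operators becomes a sum over shifts with transition weights. *)
Lemma chain_sum_step m k e s : (m < p)%N -> k = (p - m)%N -> (e < 3)%N ->
  let D := 2 * Slev k + Glev k in
  D != 0 -> D + 1 != 0 -> D - 1 != 0 ->
  let N := psum n k.-1 in
  let a := 2 * N%:R + psum gamma k + k%:R - 1 in
  let b := at1 gamma k.+1 in
  chain_sum m.+1 1 (level_quad k.-1 e) s =
  \sum_(f < 3) trans_coef (at1 n k) a b e f *:
     chain_sum m 1 (level_quad k f) (s + site_shift m *~ (1 - f%:Z)).
Proof.
move=> lt_mp kE lt_e D nD nDp nDm N a b.
have k0 : (0 < k)%N by rewrite kE subn_gt0.
have [_ tpE tmE] := trans_coef_level e k0.
rewrite /= -kE.
rewrite big_bool /= [X in _ + X = _]addrC tpE tmE -/N -/a -/b /signed_shift.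
rewrite (@chain_sum_linear m 3 (trans_coef (at1 n k) a b e) (fun=> 1) (fun f => level_quad k f)); last 2 first.
- by rewrite !big_ord_recl big_ord0 /= /trans_coef; ring.
- move=> x; rewrite !big_ord_recl big_ord0 /= addr0 /bump /=.
  by have := level_quad_decomp x lt_e nD nDp nDm k.-1; rewrite /= tpE tmE -/N -/a -/b addrA.
have ext q q' s' : q =1 q' -> chain_sum m 1 q s' = chain_sum m 1 q' s'.
  move=> qq'; rewrite (@chain_sum_linear m 1 (fun=> 1) (fun=> 1) (fun=> q')).
  - by rewrite big_ord1 scale1r.
  - by rewrite big_ord1 mulr1.
  - by move=> x; rewrite big_ord1 mul1r.
rewrite !big_ord_recl !big_ord0 /= /bump /= !addr0.
rewrite mulr1z (_ : 1 - (1 + (1 + 0))%N%:Z = -1) // mulrN1z.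
rewrite ![chain_sum m 1 (level_quad k 0) _](ext _ _ _ (fun x => (level_quad_site k x).1)).
rewrite ![chain_sum m 1 (level_quad k 2) _](ext _ _ _ (fun x => (level_quad_site k x).2)).
by rewrite !scalerBr addrACA subrKC -addrA subrKC.
Qed.

End ChainSums.

(** * Chain sums of Jacobi polynomials *)

Section Collapse.
Variables (R : realType) (p : nat) (gamma : 'I_p.+1 -> R) (n : 'I_p -> nat).
Hypothesis hgamma : Jpoly_defined gamma.

Implicit Types (s : multishift p) (k m e : nat) (i : 'I_p).

Notation chain_sum := (chain_sum gamma n (fun s => shifted (Jpoly gamma) s n)).

Definition moved s i : nat := absz ((n i)%:Z + s i).

Definition admissible k s := [forall i : 'I_p, (i < k)%N ==> (0 <= (n i)%:Z + s i)].

Lemma site_shiftE m i : (m <= p)%N ->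
  site_shift p m i = (i.+1 == p - m)%N%:Z - (i.+1 == (p - m).+1)%N%:Z.
Proof. by move=> lt_mp; rewrite /site_shift !ffunE. Qed.

Lemma mulrz_ffunE s (z : int) i : (s *~ z) i = s i *~ z.
Proof. by case: z => l; rewrite /intmul ?ffunE ffunMnE. Qed.

Lemma factor_prod_eq (n1 n2 : 'I_p -> nat) k :
  (forall i, (i < k)%N -> n1 i = n2 i) -> (k <= p)%N ->
  factor_prod gamma n1 1 k.+1 = factor_prod gamma n2 1 k.+1.
Proof.
move=> E le_kp; rewrite /factor_prod !big_nat; apply: eq_bigr => l /andP[l0 lt_lk].
case: l l0 lt_lk => // l _ lt_lk.
rewrite ltnS in lt_lk; have lt_lp := leq_trans lt_lk le_kp.
rewrite !(at1E _ (Ordinal lt_lp)) E //=.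
by congr factor; apply: eq_bigr => i lt_il; apply: E; apply: ltn_trans lt_il lt_lk.
Qed.

Lemma psum_moved s k : (k <= p)%N -> admissible k s ->
  (psum (moved s) k)%:Z = (psum n k)%:Z + psum (s : 'I_p -> int) k.
Proof.
move=> le_kp /forallP adm.
rewrite /psum !(big_morph Posz PoszD (erefl : 0%N%:Z = 0)).
rewrite -big_split; apply: eq_bigr => i lt_ik /=.
by rewrite /moved gez0_abs //; apply: (implyP (adm i)).
Qed.

Lemma admissibleS k s (lt_kp : (k < p)%N) :
  admissible k.+1 s =
  admissible k s && (0 <= (n (Ordinal lt_kp))%:Z + s (Ordinal lt_kp)).
Proof.
apply/forallP/andP => [adm|[/forallP adm ge0] i].
  split; last exact: (implyP (adm (Ordinal lt_kp)) (ltnSn k)).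
  by apply/forallP => i; apply/implyP => lt_ik; apply: (implyP (adm i)); apply: ltnW.
apply/implyP; rewrite ltnS leq_eqVlt => /orP[/eqP E|]; last exact: (implyP (adm i)).
by rewrite (_ : i = Ordinal lt_kp) //; apply: val_inj.
Qed.

Lemma eq_admissible k s s' : (forall i, (i < k)%N -> s i = s' i) ->
  admissible k s = admissible k s'.
Proof.
move=> E; apply: eq_forallb => i; case: ltnP => //= lt_ik; by rewrite E.
Qed.

(** The levels up to k have been treated and have changed the partial
    degree N_1^k by 1 - e.  Each of the remaining sites performs the three-term
    relation of its factor, so that its sum over f turns Z_1^{l+1} to the
    power f, times the shifted factor l, into Z_1^l to the power e times the
    unshifted one.  At the last level Z_1^{p+1} = 1 and nothing remains of the
    power. *)
Lemma chain_sum_Jpoly m e s :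
  (m <= p)%N -> (e < 3)%N ->
  (forall k, (p - m < k <= p)%N ->
     let D := 2 * Slev R n k + Glev gamma k in
     [/\ D != 0, D + 1 != 0 & D - 1 != 0]) ->
  let k := (p - m)%N in
  (forall i, (k < i)%N -> s i = 0) ->
  (forall i, i = k :> nat -> s i = e%:Z - 1) ->
  psum (s : 'I_p -> int) k = 1 - e%:Z ->
  chain_sum m 1 (level_quad gamma n k e) s =
  if admissible k s then
    factor_prod gamma (moved s) 1 k.+1 * Zsum R p k.+1 ^+ e *
      factor_prod gamma n k.+1 p.+1
  else 0.
Proof.
elim: m e s => [|m IH] e s lt_mp lt_e nD k s_gt s_eq s_sum.
  rewrite /= scale1r /shifted /k subn0 /Zsum ltnn expr1n mulr1.
  rewrite [factor_prod _ _ p.+1 p.+1]big_geq // mulr1.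
  have -> : admissible p s = [forall i, 0 <= (n i)%:Z + s i].
    by apply: eq_forallb => i; rewrite ltn_ord.
  by case: ifP => // _; rewrite Jpoly_factor.
have kE : (p - m = k.+1)%N by rewrite /k subnSK.
have lt_kp : (k < p)%N by rewrite /k; lia.
have [nD0 nDp nDm] : [/\ 2 * Slev R n k.+1 + Glev gamma k.+1 != 0,
    2 * Slev R n k.+1 + Glev gamma k.+1 + 1 != 0 &
    2 * Slev R n k.+1 + Glev gamma k.+1 - 1 != 0].
  by apply: nD; rewrite /k; lia.
have := @chain_sum_step _ _ gamma n _ (fun s => shifted (Jpoly gamma) s n) m k.+1 e s
  lt_mp (esym kE) lt_e nD0 nDp nDm.
rewrite succnK => ->.
have nDall l : (p - m < l <= p)%N -> let D := 2 * Slev R n l + Glev gamma l in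
     [/\ D != 0, D + 1 != 0 & D - 1 != 0].
  by move=> hl; apply: nD; lia.
set a := 2 * _ + _ + _ - 1; set b := at1 gamma k.+2.
(* the shift after the site of level k + 1 has changed N_1^{k+1} by 1 - f *)
pose sf f := s + site_shift p m *~ (1 - f%:Z).
have sfE f i : sf f i = s i + ((i.+1 == k.+1)%N%:Z - (i.+1 == k.+2)%N%:Z) * (1 - f%:Z).
  by rewrite /sf ffunE mulrz_ffunE site_shiftE ?(ltnW lt_mp) // kE mulrzz.
have step (f : 'I_3) : chain_sum m 1 (level_quad gamma n k.+1 f) (sf f) =
  if admissible k.+1 (sf f) then
    factor_prod gamma (moved (sf f)) 1 k.+2 * Zsum R p k.+2 ^+ f *
      factor_prod gamma n k.+2 p.+1
  else 0.
  rewrite -kE; apply: IH => //; first exact: ltnW; rewrite kE.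
  - move=> i lt_ki; rewrite sfE s_gt 1?ltnW // !eqSS (gtn_eqF lt_ki).
    by rewrite (gtn_eqF (ltnW lt_ki)) /=; ring.
  - move=> i iE; rewrite sfE s_gt ?iE // !eqSS eqxx (gtn_eqF (ltnSn k)) /=; ring.
  - rewrite psumS (at1E _ (Ordinal lt_kp)) sfE /= eqxx (ltn_eqF (ltnSn k.+1)).
    rewrite (s_eq (Ordinal lt_kp)) //.
    have -> : psum (sf f : 'I_p -> int) k = psum (s : 'I_p -> int) k.
      apply: eq_bigr => i lt_ik; rewrite sfE !eqSS (ltn_eqF lt_ik).
      by rewrite (ltn_eqF (leqW lt_ik)) /=; ring.
    by rewrite s_sum /=; ring.
under eq_bigr do rewrite -/(sf _) step.
have adm_f f : admissible k.+1 (sf f) =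
    admissible k s && (f <= at1 n k.+1 + e)%N.
  rewrite (admissibleS _ lt_kp) (eq_admissible (s' := s)); last first.
    move=> i lt_ik; rewrite sfE !eqSS (ltn_eqF lt_ik).
    by rewrite (ltn_eqF (leqW lt_ik)) /=; ring.
  congr (_ && _); rewrite (at1E n (Ordinal lt_kp)) sfE s_eq //= eqxx.
  rewrite (ltn_eqF (ltnSn k.+1)); lia.
under eq_bigr do rewrite adm_f.
case: (boolP (admissible k s)) => [adm|_]; last first.
  by rewrite big1 // => f _; rewrite scaler0.
have hk : (1 <= k.+1 <= p)%N by [].
have -> : factor_prod gamma n k.+1 p.+1 =
    factor gamma k.+1 (psum n k) (at1 n k.+1) * factor_prod gamma n k.+2 p.+1.
  by rewrite /factor_prod big_ltn.
have psN := psum_moved (ltnW lt_kp) adm.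
rewrite s_sum in psN.
set F1 := factor_prod _ _ 1 _; set F2 := factor_prod _ n _ _.
have := @jacobi_form_three_term _ _ (at1 n k.+1) a b e (Zsum R p k.+1) (Zsum R p k.+2)
  (fun m => poch_at1_neq0 hgamma m hk) lt_e.
have [<- _ _] := trans_coef_level gamma n e (ltn0Sn k).
move=> /(_ nD0 nDp nDm) T3.
rewrite mulrA -[F1 * _ * _]mulrA [_ ^+ e * factor _ _ _ _]T3.
rewrite mulr_sumr mulr_suml; apply: eq_bigr => f _ /=.
rewrite -scalerAr -scalerAl; congr (_ *: _).
case: ifP => le_f; last by rewrite mulr0 mul0r.
rewrite !mulrA; congr (_ * _); rewrite -[F1 * _ * _]mulrA [_ ^+ f * _]mulrC mulrA.
congr (_ * _).
rewrite /factor_prod big_nat_recr //= -/(factor_prod gamma (moved (sf f)) 1 k.+1).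
congr (_ * _).
  apply: factor_prod_eq; last exact: ltnW.
  move=> i lt_ik; rewrite /moved sfE !eqSS (ltn_eqF lt_ik).
  by rewrite (ltn_eqF (leqW lt_ik)) /=; congr absz; ring.
have -> : psum (moved (sf f)) k = psum (moved s) k.
  apply: eq_bigr => i lt_ik; rewrite /moved sfE !eqSS (ltn_eqF lt_ik).
  by rewrite (ltn_eqF (leqW lt_ik)) /=; congr absz; ring.
have -> : at1 (moved (sf f)) k.+1 = (at1 n k.+1 + e - f)%N.
  rewrite !(at1E _ (Ordinal lt_kp)) /moved sfE s_eq //= eqxx (ltn_eqF (ltnSn k.+1)).
  move: le_f; rewrite (at1E n (Ordinal lt_kp)); lia.
rewrite /factor; congr jacobi_form.
have -> : (psum (moved s) k)%:R = (psum n k)%:R + 1 - e%:R :> R.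
  have := congr1 (fun x : int => x%:~R : R) psN.
  by rewrite !(intrD, intrB) -!pmulrn => -> /=; ring.
by rewrite /a /=; ring.
Qed.

End Collapse.

(** * Sums over signed subsets *)

Section SignedSubsets.
Variables (j : nat) (V : nmodType).
Implicit Types (P Q : {set 'I_j}) (m : nat) (i : 'I_j).

Definition signed_above m (PQ : {set 'I_j} * {set 'I_j}) : bool :=
  [disjoint PQ.1 & PQ.2] && [forall i in PQ.1 :|: PQ.2, (m <= i)%N].

Lemma signed_aboveP m P Q :
  reflect ((forall i, i \in P -> i \notin Q) /\
           (forall i, (i \in P) || (i \in Q) -> (m <= i)%N))
    (signed_above m (P, Q)).
Proof.
apply: (iffP andP) => -[/= dis ge].
  split=> [i iP|i iPQ]; first by rewrite (disjointFr dis).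
  by move/forall_inP: ge; apply; rewrite finset.in_setU.
split; last by apply/forall_inP => i; rewrite finset.in_setU => /ge.
by apply/pred0P => i /=; apply/andP => -[/dis/negP].
Qed.

(** The smallest index a of the range is absent, or has sign 1, or
    has sign -1. *)
Lemma sum_signed_split m (lt_mj : (m < j)%N)
    (F : {set 'I_j} * {set 'I_j} -> V) :
  let a := Ordinal lt_mj in
  \sum_(PQ | signed_above m PQ) F PQ =
  \sum_(PQ | signed_above m.+1 PQ)
    (F PQ + (F (a |: PQ.1, PQ.2) + F (PQ.1, a |: PQ.2))).
Proof.
move=> a; rewrite 2!big_split /=.
rewrite (bigID (fun PQ : {set 'I_j} * {set 'I_j} => a \in PQ.1)) /=.
rewrite [X in _ + X](bigID (fun PQ : {set 'I_j} * {set 'I_j} => a \in PQ.2)) /= [RHS]addrC -addrA.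
have lt_a i : (m < i)%N = (m <= i)%N && (i != a).
  by rewrite ltn_neqAle andbC eq_sym.
congr (_ + (_ + _)).
- rewrite (reindex_onto (fun PQ => (a |: PQ.1, PQ.2)) (fun PQ => (PQ.1 :\ a, PQ.2))) /=.
    apply: eq_bigl => -[P Q] /=.
    apply/andP/idP => [[/andP[/signed_aboveP[dis ge] _] /eqP[E]]|/signed_aboveP[dis ge]].
      have aP : a \notin P by rewrite -E !finset.inE eqxx.
      have aQ : a \notin Q by apply: dis; rewrite finset.setU11.
      apply/signed_aboveP; split=> [i iP|i iPQ].
        by apply: dis; rewrite finset.in_setU1 iP orbT.
      rewrite lt_a ge; last by rewrite finset.in_setU1 -orbA iPQ orbT.
      by apply/eqP => ia; move: iPQ; rewrite ia (negbTE aP) (negbTE aQ).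
    have aP : a \notin P by apply/negP => aP; have := ge a; rewrite aP ltnn => /(_ isT).
    have aQ : a \notin Q.
      by apply/negP => aQ; have := ge a; rewrite aQ orbT ltnn => /(_ isT).
    split; last by rewrite finset.setU1K.
    rewrite finset.setU11 andbT; apply/signed_aboveP; split=> [i|i].
      by rewrite finset.in_setU1 => /orP[/eqP-> //|/dis].
    rewrite finset.in_setU1 -orbA => /orP[/eqP-> //|/ge]; exact: ltnW.
  by move=> [P Q] /= /andP[_ aP]; rewrite finset.setD1K.
- rewrite (reindex_onto (fun PQ => (PQ.1, a |: PQ.2)) (fun PQ => (PQ.1, PQ.2 :\ a))) /=.
    apply: eq_bigl => -[P Q] /=.
    apply/andP/idP => [[/andP[/andP[/signed_aboveP[dis ge] aP] _] /eqP[E]]|/signed_aboveP[dis ge]].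
      have aQ : a \notin Q by rewrite -E !finset.inE eqxx.
      apply/signed_aboveP; split=> [i iP|i iPQ].
        by have := dis i iP; rewrite finset.in_setU1 negb_or => /andP[].
      rewrite lt_a ge; last by rewrite finset.in_setU1 orbCA iPQ orbT.
      by apply/eqP => ia; move: iPQ; rewrite ia (negbTE aP) (negbTE aQ).
    have aP : a \notin P by apply/negP => aP; have := ge a; rewrite aP ltnn => /(_ isT).
    have aQ : a \notin Q.
      by apply/negP => aQ; have := ge a; rewrite aQ orbT ltnn => /(_ isT).
    split; last by rewrite finset.setU1K.
    rewrite finset.setU11 aP !andbT; apply/signed_aboveP; split=> [i iP|i].
      rewrite finset.in_setU1 negb_or dis // andbT.
      by apply/eqP => ia; move: iP; rewrite ia (negbTE aP).
    rewrite finset.in_setU1 orbCA => /orP[/eqP-> //|/ge]; exact: ltnW.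
  by move=> [P Q] /= /andP[_ aQ]; rewrite finset.setD1K.
- apply: eq_bigl => -[P Q] /=.
  apply/andP/idP => [[/andP[/signed_aboveP[dis ge] aP] aQ]|/signed_aboveP[dis ge]].
    apply/signed_aboveP; split=> // i iPQ; rewrite lt_a ge //.
    by apply/eqP => ia; move: iPQ; rewrite ia (negbTE aP) (negbTE aQ).
  have aP : a \notin P by apply/negP => aP; have := ge a; rewrite aP ltnn => /(_ isT).
  have aQ : a \notin Q.
    by apply/negP => aQ; have := ge a; rewrite aQ orbT ltnn => /(_ isT).
  split=> //; apply/andP; split=> //.
  by apply/signed_aboveP; split=> // i /ge; exact: ltnW.
Qed.

End SignedSubsets.

Section SetSums.
Variables (R : realType) (p : nat) (gamma : 'I_p.+1 -> R) (n : 'I_p -> nat).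
Variables (V : lmodType R) (j : nat).
Implicit Types (s d : multishift p) (f g : multishift p -> V).

(** The composition of the differences E^d - 1.  For d = - e_i this is minus
    the backward difference, so the sign (-1)^|nu^-| is absorbed. *)
Fixpoint diffop (ds : seq (multishift p)) f s : V :=
  if ds is d :: ds' then diffop ds' f (s + d) - diffop ds' f s else f s.

Lemma subrACA (W : zmodType) (x y z t : W) : (x - y) - (z - t) = (x - z) - (y - t).
Proof. by rewrite !opprB addrACA [RHS]addrACA [- z - y]addrC. Qed.

Lemma diffop_middle ds1 ds2 d f s :
  diffop (ds1 ++ d :: ds2) f s = diffop (d :: ds1 ++ ds2) f s.
Proof.
elim: ds1 s => [|d1 ds1 IH] //= s; rewrite !IH /=.
by rewrite subrACA [s + d + d1]addrAC.
Qed.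

Lemma diffop_shift ds d f s :
  diffop ds (fun s => f (s + d) - f s) s = diffop (d :: ds) f s.
Proof. by elim: ds s => [|d1 ds IH] //= s; rewrite !IH /= subrACA [s + d + d1]addrAC. Qed.

Lemma eq_diffop ds f g s : f =1 g -> diffop ds f s = diffop ds g s.
Proof. by move=> fg; elim: ds s => [|d ds IH] //= s; rewrite !IH. Qed.

Lemma diffopD ds f g s :
  diffop ds (fun s => f s + g s) s = diffop ds f s + diffop ds g s.
Proof. by elim: ds s => [|d ds IH] //= s; rewrite !IH opprD addrACA. Qed.

Lemma diffopZ ds c f s : diffop ds (fun s => c *: f s) s = c *: diffop ds f s.
Proof. by elim: ds s => [|d ds IH] //= s; rewrite !IH scalerBr. Qed.

(** For the chain with signs nu, chain_lead is A_nu without its first two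
    factors, those that contain beta_0 or N, and chain_quad is the polynomial
    from which the next site of a longer chain takes its value.  The empty
    chain has lead -1 although it does not occur in the operator: it is the
    term that accounts for the 1 in 1 - Z_1^{p+1-j}. *)
Fixpoint chain_quad (l : seq (nat * bool)) (x : R) : R :=
  if l is (i, eps) :: l' then
    chain_quad l' (tau gamma n (p - i) eps) / site_den gamma n (p - i) eps *
      site_quad gamma n (p - i) eps x
  else - level_quad gamma n (p - j) 1 x.

Definition chain_lead (l : seq (nat * bool)) : R :=
  if l is (i, eps) :: l' then
    chain_quad l' (tau gamma n (p - i) eps) / site_den gamma n (p - i) eps
  else -1.

Definition signed_sites (P Q : {set 'I_j}) : seq (nat * bool) :=
  [seq (val i, i \in Q) | i <- enum (P :|: Q)].

Definition set_shifts (P Q : {set 'I_j}) : seq (multishift p) :=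
  [seq signed_shift p (val i) false | i <- enum P] ++
  [seq signed_shift p (val i) true | i <- enum Q].

Lemma enum_setU1_min (a : 'I_j) (P : {set 'I_j}) :
  (forall i, i \in P -> (a < i)%N) -> enum (a |: P) = a :: enum P.
Proof.
move=> lt_a; apply: (inj_map val_inj).
have srt (S : {set 'I_j}) : sorted ltn [seq val i | i <- enum S].
  rewrite {1}/enum_mem -enumT; apply: (subseq_sorted ltn_trans (s2 := iota 0 j)).
    by rewrite -val_enum_ord; apply: map_subseq; exact: filter_subseq.
  exact: iota_ltn_sorted.
apply: (irr_sorted_eq ltn_trans ltnn (srt _)).
  rewrite /= path_min_sorted //; apply/allP => _ /mapP[i + ->].
  by rewrite mem_enum => /lt_a.
move=> x; apply/mapP/idP => [[i + ->]|].
  rewrite mem_enum finset.in_setU1 /= inE => /orP[/eqP->|iP]; first by rewrite eqxx.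
  by rewrite map_f ?orbT // mem_enum.
rewrite /= inE => /orP[/eqP->|/mapP[i iP ->]].
  by exists a; rewrite // mem_enum finset.setU11.
by exists i; rewrite // mem_enum finset.in_setU1; move: iP; rewrite mem_enum => ->; rewrite orbT.
Qed.

Lemma signed_sites_pos (a : 'I_j) (P Q : {set 'I_j}) :
  signed_above a.+1 (P, Q) ->
  signed_sites (a |: P) Q = (val a, false) :: signed_sites P Q.
Proof.
move=> /signed_aboveP[_ ge]; rewrite /signed_sites -finset.setUA enum_setU1_min /=.
  by case: (boolP (a \in Q)) => // aQ; have := ge a; rewrite aQ orbT ltnn => /(_ isT).
by move=> i; rewrite finset.in_setU; exact: ge.
Qed.

Lemma signed_sites_neg (a : 'I_j) (P Q : {set 'I_j}) :
  signed_above a.+1 (P, Q) ->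
  signed_sites P (a |: Q) = (val a, true) :: signed_sites P Q.
Proof.
move=> /signed_aboveP[_ ge]; rewrite /signed_sites finset.setUCA enum_setU1_min /=.
  rewrite finset.setU11; congr (_ :: _); apply/eq_in_map => i.
  rewrite mem_enum finset.in_setU => /ge lt_ai; congr (_, _).
  by rewrite finset.in_setU1 -val_eqE /= (gtn_eqF lt_ai).
by move=> i; rewrite finset.in_setU; exact: ge.
Qed.

Variable Phi : multishift p -> V.

Definition signed_term (w : R -> (R -> R) -> multishift p -> V)
    (PQ : {set 'I_j} * {set 'I_j}) : V :=
  let l := signed_sites PQ.1 PQ.2 in
  diffop (set_shifts PQ.1 PQ.2) (w (chain_lead l) (chain_quad l)) 0.

(** The sites are moved one by one from the subsets to the chain
    sum, in increasing order: when its turn comes, the site m is smaller than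
    the other sites of the subsets, so it is the head of their chain. *)
Lemma signed_sum_chain_sum m : (m <= j)%N ->
  \sum_(PQ | signed_above 0 PQ) signed_term (chain_sum gamma n Phi 0) PQ =
  \sum_(PQ | signed_above m PQ) signed_term (chain_sum gamma n Phi m) PQ.
Proof.
elim: m => [//|m IH] lt_mj; rewrite IH ?(ltnW lt_mj) //.
rewrite (sum_signed_split lt_mj); apply: eq_bigr => -[P Q] valid.
set a := Ordinal lt_mj; rewrite /signed_term /=.
rewrite signed_sites_pos // signed_sites_neg //.
set l := signed_sites P Q; set ds := set_shifts P Q.
have scal (c : R) q s : chain_sum gamma n Phi m c (fun x => c * q x) s =
    c *: chain_sum gamma n Phi m 1 q s.
  rewrite (chain_sum_linear gamma n Phi m (c := fun=> c) (a := fun _ : 'I_1 => 1) (q := fun=> q)).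
  - by rewrite big_ord1.
  - by rewrite big_ord1 mulr1.
  - by move=> x; rewrite big_ord1.
rewrite diffopD; congr (_ + _).
have lin eps : diffop (signed_shift p m eps :: ds)
    (chain_sum gamma n Phi m (chain_lead ((m, eps) :: l)) (chain_quad ((m, eps) :: l))) 0 =
  diffop ds (fun s => (chain_quad l (tau gamma n (p - m) eps) / site_den gamma n (p - m) eps) *:
    (chain_sum gamma n Phi m 1 (site_quad gamma n (p - m) eps) (s + signed_shift p m eps)
     - chain_sum gamma n Phi m 1 (site_quad gamma n (p - m) eps) s)) 0.
  rewrite diffopZ diffop_shift -diffopZ; apply: eq_diffop => s; exact: scal.
have sh_pos : set_shifts (a |: P) Q = signed_shift p m false :: ds.
  rewrite /set_shifts enum_setU1_min //.
  by move=> i iP; move/signed_aboveP: valid => [_]; apply; rewrite iP.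
have sh_neg : set_shifts P (a |: Q) =
    [seq signed_shift p (val i) false | i <- enum P] ++
    signed_shift p m true :: [seq signed_shift p (val i) true | i <- enum Q].
  rewrite /set_shifts enum_setU1_min //.
  by move=> i iQ; move/signed_aboveP: valid => [_]; apply; rewrite iQ orbT.
rewrite sh_pos sh_neg diffop_middle !lin -diffopD; apply: eq_diffop => s.
by rewrite big_bool addrC.
Qed.

Lemma signed_sum_collapse :
  \sum_(PQ | signed_above 0 PQ) signed_term (chain_sum gamma n Phi 0) PQ =
  - chain_sum gamma n Phi j 1 (level_quad gamma n (p - j) 1) 0.
Proof.
rewrite (signed_sum_chain_sum (leqnn j)).
rewrite (big_pred1 (finset.set0, finset.set0)); last first.
  move=> [P Q]; apply/signed_aboveP/eqP => [[_ ge]|[-> ->]].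
    have nin i : (i \in P) || (i \in Q) = false.
      by apply/negP => /ge; rewrite leqNgt ltn_ord.
    congr (_, _); apply/finset.setP => i; rewrite finset.inE; have := nin i;
      by case: (i \in P) (i \in Q) => [] [].
  by split=> i; rewrite !finset.inE.
rewrite /signed_term /signed_sites /set_shifts finset.setU0 enum_set0 /=.
rewrite (chain_sum_linear gamma n Phi j (c := fun=> -1) (a := fun _ : 'I_1 => 1)
  (q := fun=> level_quad gamma n (p - j) 1)).
- by rewrite big_ord1 scaleN1r.
- by rewrite big_ord1 mulr1.
- by move=> x; rewrite big_ord1 mulN1r.
Qed.

End SetSums.

(** * Difference operators acting on functions of the shift *)

Section DifferenceOperators.
Variables (R : realType) (p : nat) (V : lmodType R).
Implicit Types (L : dop R p) (h : multishift p -> V) (x : 'I_p -> R)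
  (beta : nat -> R) (N : R) (s : multishift p).

(** The operator L with its coefficients evaluated at one point, acting on a
    function h of the shift.  Taking for h an indicator function gives a
    coefficient of L. *)
Definition dapp L h x beta N : V := \sum_(t <- L) t.1 x beta N *: h t.2.

Lemma dapp_dcomp L1 L2 h x beta N :
  dapp (Defs.dcomp L1 L2) h x beta N =
  \sum_(t <- L1) t.1 x beta N *:
    dapp L2 (fun s => h (t.2 + s)) (translate t.2 x) beta N.
Proof.
rewrite /dapp /Defs.dcomp big_allpairs_dep; apply: eq_bigr => t1 _.
by rewrite scaler_sumr; apply: eq_bigr => t2 _ /=; rewrite scalerA.
Qed.

Lemma translate0 x : translate 0 x = x.
Proof. by apply: funext => i; rewrite /translate ffunE addr0. Qed.

Lemma dapp_dscal c L h x beta N :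
  dapp (Defs.dcomp (dscal c) L) h x beta N = c x beta N *: dapp L h x beta N.
Proof.
rewrite dapp_dcomp /dscal big_seq1 /= translate0; congr (_ *: _).
by apply: eq_bigr => t _; rewrite add0r.
Qed.

Lemma diffop_translate ds d h s :
  diffop ds (fun s => h (d + s)) s = diffop ds h (d + s).
Proof. by elim: ds s => [|d1 ds IH] //= s; rewrite !IH addrA. Qed.

Lemma dapp_Deltas ks h x beta N :
  dapp (foldr (@Defs.dcomp R p) (dscal (const_coefn 1)) (map (@Delta_ R p) ks)) h x beta N =
  diffop (map (unit_shift p) ks) h 0.
Proof.
elim: ks h x => [|k ks IH] h x /=; first by rewrite /dapp big_seq1 scale1r.
rewrite dapp_dcomp /Delta_ big_cons big_seq1 /= !IH !diffop_translate.
by rewrite !add0r [_ + 0](addr0 (unit_shift p k)) scale1r scaleN1r.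
Qed.

Lemma dapp_Nablas ks h x beta N :
  dapp (foldr (@Defs.dcomp R p) (dscal (const_coefn 1)) (map (@Nabla_ R p) ks)) h x beta N =
  (-1) ^+ size ks *: diffop (map (fun k => - unit_shift p k) ks) h 0.
Proof.
elim: ks h x => [|k ks IH] h x /=; first by rewrite /dapp big_seq1.
rewrite dapp_dcomp /Nabla_ big_cons big_seq1 /= !IH !diffop_translate.
rewrite !addr0 add0r scale1r scaleN1r exprS mulN1r scaleNr.
by rewrite -scalerBr -opprB scalerN.
Qed.

Lemma diffop_cat ds1 ds2 h s :
  diffop ds1 (diffop ds2 h) s = diffop (ds1 ++ ds2) h s.
Proof. by elim: ds1 s => [|d ds1 IH] //= s; rewrite !IH. Qed.

Lemma b_shiftD s t : b_shift (s + t) = b_shift s + b_shift t.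
Proof.
by rewrite /b_shift -big_split; apply: eq_bigr => i _; rewrite ffunE mulrzDr.
Qed.

Lemma b_shiftN s : b_shift (- s) = - b_shift s.
Proof.
by rewrite /b_shift -sumrN; apply: eq_bigr => i _; rewrite ffunE mulrNz.
Qed.

Lemma b_shift0 : b_shift (0 : multishift p) = 0.
Proof. by rewrite /b_shift big1 // => i _; rewrite ffunE mulr0z. Qed.

Lemma b_shift_unit (i : nat) : (i < p)%N -> b_shift (unit_shift p i.+1) = site_shift p i.
Proof.
move=> lt_ip; rewrite /b_shift (bigD1 (Ordinal lt_ip)) //= ffunE eqxx mulr1z.
rewrite big1 ?addr0; last first.
  by move=> l; rewrite -val_eqE /= ffunE eqSS => /negbTE->; rewrite mulr0z.
by rewrite !subSS subSn // ltnW.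
Qed.

Lemma diffop_b_shift ds h s :
  diffop ds (fun s => h (b_shift s)) s = diffop (map (@b_shift p) ds) h (b_shift s).
Proof. by elim: ds s => [|d ds IH] //= s; rewrite !IH b_shiftD. Qed.

Lemma dapp_Lq j h x beta M : (j <= p)%N ->
  dapp (Lq R p j) (fun s => h (b_shift s)) x beta M =
  \sum_(nu : {set 'I_j} * {set 'I_j} |
      [disjoint nu.1 & nu.2] && (nu.1 :|: nu.2 != finset.set0))
    A_ nu.1 nu.2 x beta M *: diffop (set_shifts p nu.1 nu.2) h 0.
Proof.
move=> le_jp.
rewrite /Lq (big_morph (fun L => dapp L (fun s => h (b_shift s)) x beta M)
  (id1 := 0) (op1 := +%R)); last 2 first.
- by move=> L1 L2; rewrite /dapp big_cat.
- by rewrite /dapp big_nil.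
apply: eq_bigr => -[P Q] _ /=.
rewrite !dapp_dscal dapp_dcomp.
under eq_bigr do rewrite dapp_Nablas (diffop_translate _ _ (fun s => h (b_shift s))) addr0.
rewrite -/(dapp _ (fun s => (-1) ^+ size (positions Q) *:
  diffop [seq - unit_shift p k | k <- positions Q] (fun s => h (b_shift s)) s) x beta M).
rewrite dapp_Deltas diffopZ diffop_cat diffop_b_shift b_shift0.
rewrite !scalerA.
have -> : size (positions Q) = #|Q| by rewrite size_map -cardE.
rewrite /const_coefn [_ * A_ _ _ _ _ _]mulrC -mulrA -expr2 sqrr_sign mulr1.
congr (_ *: diffop _ _ _).
rewrite map_cat /set_shifts /positions -!map_comp; congr (_ ++ _).
  by apply: eq_map => i /=; rewrite b_shift_unit // (leq_trans _ le_jp).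
by apply: eq_map => i /=; rewrite b_shiftN b_shift_unit // (leq_trans _ le_jp).
Qed.

End DifferenceOperators.

Lemma foldr_reflect_var (R : realType) p (l : seq nat) (c : coefn R p) x beta N :
  uniq l ->
  foldr (@reflect_var R p) c l x beta N =
  c (fun i => if i.+1 \in l then - x i - beta i.+1 else x i) beta N.
Proof.
elim: l x => [|k l IH] x //= /andP[nk Ul].
rewrite /reflect_var IH //; congr c; apply: funext => i.
rewrite inE; case: eqP => [->|_] //=.
by rewrite (negbTE nk).
Qed.

(** * The coefficients of the operators in n *)

Section Evaluation.
Variables (R : realType) (p : nat) (gamma : 'I_p.+1 -> R) (n : 'I_p -> nat).
Variables (j : nat) (hj : (0 < j <= p)%N).

Let nr : 'I_p -> R := fun i => (n i)%:R.

Notation sigma := (sigma gamma n).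
Notation tau := (tau gamma n).
Notation Slev := (Slev R n).
Notation Glev := (Glev gamma).

Lemma psum_nr k : psum nr k = Slev k.
Proof. by rewrite /Defs.psum /Slev natr_sum. Qed.

Lemma b_betaE beta0 N (i : nat) : (i <= p)%N ->
  b_beta p (beta_gamma gamma beta0) N i.+1 = - Glev (p - i) - 2 * N.
Proof.
move=> le_ip; rewrite /b_beta /= subSS subSn // /beta_gamma psum0 -natr1 /Glev.
by ring.
Qed.

Lemma b_xE beta0 N (i : 'I_p) :
  b_x nr (beta_gamma gamma beta0) N i = Slev (p - i) + Glev (p - i) + N.
Proof.
rewrite /b_x !subSS subSn; last exact: ltnW.
rewrite psum_nr /beta_gamma psum0 -natr1 /Glev.
by ring.
Qed.

(** The value of A_nu without its first two factors. *)
Definition A01_tail (X beta : nat -> R) M (s : seq nat) : R :=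
  ((\prod_(1 <= k < size s)
      ((X (nth 0%N s k) + X (nth 0%N s k.-1) + beta (nth 0%N s k)) *
       (X (nth 0%N s k) + X (nth 0%N s k.-1) + beta (nth 0%N s k) + 1))) /
   (\prod_(i <- s) ((2 * X i + beta i) * (2 * X i + beta i + 1)))) *
  ((X (last 0%N s) + beta j.+1 + M) * (M - X (last 0%N s))).

Lemma A01_tailE (X beta : nat -> R) M N (l : seq (nat * bool)) :
  (forall t, t \in l -> X t.1.+1 = tau (p - t.1) t.2 + N /\
     beta t.1.+1 = sigma (p - t.1) t.2 - tau (p - t.1) t.2 - 2 * N) ->
  (forall u, (u + N + beta j.+1 + M) * (M - (u + N)) = - level_quad gamma n (p - j) 1 u) ->
  l != [::] ->
  A01_tail X beta M [seq t.1.+1 | t <- l] = chain_lead gamma n j l.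
Proof.
move=> Hl Hend; elim: l Hl => [//|[i eps] l IH] Hl _.
have [Xi Bi] := Hl (i, eps) (mem_head _ _).
have dE : (2 * X i.+1 + beta i.+1) * (2 * X i.+1 + beta i.+1 + 1) = site_den gamma n (p - i) eps.
  by rewrite Xi Bi /site_den /=; ring.
case: l IH Hl => [_ _|[i2 eps2] l IH Hl].
  rewrite /A01_tail /= big_geq // big_seq1 dE Xi /= Hend.
  by rewrite mul1r mulrC.
have [Xi2 Bi2] := Hl (i2, eps2) (mem_behead (s := [:: (i, eps), (i2, eps2) & l]) (mem_head _ _)).
have {}IH : A01_tail X beta M [seq t.1.+1 | t <- (i2, eps2) :: l] =
    chain_lead gamma n j ((i2, eps2) :: l).
  by apply: IH => // t tl; apply: Hl; rewrite inE tl orbT.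
have -> : chain_lead gamma n j ((i, eps) :: (i2, eps2) :: l) =
    chain_lead gamma n j ((i2, eps2) :: l) *
    site_quad gamma n (p - i2) eps2 (tau (p - i) eps) / site_den gamma n (p - i) eps by [].
rewrite -IH {IH} /A01_tail /= big_nat_recl //= [\prod_(i0 <- _ :: _ :: _) _]big_cons dE.
rewrite invfM; set P1 := \prod_(1 <= k < _) _; set Q1 := \prod_(1 <= k < _) _.
have -> : P1 = Q1.
  by rewrite /P1 /Q1 !big_nat; apply: eq_bigr => -[|k].
have -> : (X i2.+1 + X i.+1 + beta i2.+1) * (X i2.+1 + X i.+1 + beta i2.+1 + 1) =
    site_quad gamma n (p - i2) eps2 (tau (p - i) eps).
  by rewrite Xi Xi2 Bi2 /site_quad /=; ring.
by ring.
Qed.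

Definition first_sigma (l : seq (nat * bool)) : R :=
  let t := head (0%N, false) l in sigma (p - t.1) t.2.

(** Only the first two factors of A_nu depend on beta_0 and N, in the
    form (beta_0 + N - S)(N - S): in the linking factors N cancels, and so it
    does in the last two factors, also when x_{j+1} stands for N. *)
Lemma A_eval beta0 N (P Q : {set 'I_j}) :
  P :|: Q != finset.set0 ->
  let x := b_x nr (beta_gamma gamma beta0) N in
  let beta := b_beta p (beta_gamma gamma beta0) N in
  let l := signed_sites P Q in
  A_ P Q x beta (if j == p then N else at1 x j.+1) =
  (beta0 + N - first_sigma l) * (N - first_sigma l) * chain_lead gamma n j l.
Proof.
move=> nPQ x beta l; set M := if _ then _ else _.
have le_jp : (j <= p)%N by case/andP: hj.
rewrite /A_ foldr_reflect_var; last first.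
  by rewrite map_inj_uniq ?enum_uniq // => i i' [] /val_inj.
set x' := fun i : 'I_p => _.
have posE : positions (P :|: Q) = [seq t.1.+1 | t <- l].
  by rewrite /l /signed_sites /positions -map_comp.
have x'E (i : 'I_j) : at1 x' i.+1 = tau (p - i) (i \in Q) + N.
  have lt_ip : (i < p)%N by apply: leq_trans le_jp.
  rewrite (at1E x' (Ordinal lt_ip)) /x' /=.
  have -> : (i.+1 \in positions Q) = (i \in Q).
    apply/mapP/idP => [[i' + [/val_inj->]]|iQ]; first by rewrite mem_enum.
    by exists i; rewrite ?mem_enum.
  rewrite /x b_xE /beta b_betaE /= ?(ltnW lt_ip) // tauE.
  by case: (i \in Q); ring.
have nl : l != [::].
  rewrite -size_eq0 size_map -cardE; apply: contra nPQ => /eqP PQ0.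
  by rewrite -finset.cards_eq0 PQ0.
have Hl t : t \in l -> at1 x' t.1.+1 = tau (p - t.1) t.2 + N /\
     beta t.1.+1 = sigma (p - t.1) t.2 - tau (p - t.1) t.2 - 2 * N.
  move=> /mapP[i _ ->] /=; split; first exact: x'E.
  rewrite /beta b_betaE; last by apply: ltnW; apply: leq_trans le_jp.
  by rewrite sigma_sub_tau.
have Hend u : (u + N + beta j.+1 + M) * (M - (u + N)) = - level_quad gamma n (p - j) 1 u.
  rewrite /beta b_betaE // /M /level_quad /=; case: eqP => [->|/eqP njp].
    by rewrite subnn /Slev psum0; ring.
  have lt_jp : (j < p)%N by rewrite ltn_neqAle njp.
  by rewrite (at1E x (Ordinal lt_jp)) /x b_xE /=; ring.
rewrite -(A01_tailE Hl Hend nl) /A01 posE.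
have -> : beta 0%N = beta0.
  by rewrite /beta /b_beta /= /beta_gamma psum0 !addr0.
have -> : (beta0 + N - first_sigma l) * (N - first_sigma l) =
   (at1 x' (head 0%N [seq t.1.+1 | t <- l]) + beta (head 0%N [seq t.1.+1 | t <- l]) - beta0) *
   (at1 x' (head 0%N [seq t.1.+1 | t <- l]) + beta (head 0%N [seq t.1.+1 | t <- l])).
  case: (l) nl Hl => [//|t l'] _ Hl; have [] := Hl t (mem_head _ _).
  by rewrite /first_sigma /= => -> ->; ring.
by rewrite /A01_tail; ring.
Qed.

Lemma dapp_Ln (V : lmodType R) (h : multishift p -> V) beta0 N :
  dapp (Ln R p j) h nr (beta_gamma gamma beta0) N =
  \sum_(PQ : {set 'I_j} * {set 'I_j} |
      signed_above 0 PQ && (PQ.1 :|: PQ.2 != finset.set0))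
    ((beta0 + N - first_sigma (signed_sites PQ.1 PQ.2)) *
     (N - first_sigma (signed_sites PQ.1 PQ.2))) *:
    signed_term gamma n (chain_sum gamma n h 0) PQ.
Proof.
have le_jp : (j <= p)%N by case/andP: hj.
rewrite /dapp /Ln /b_dop /Lx !big_map /=.
rewrite -[LHS]/(dapp (Lq R p j) (fun s => h (b_shift s)) _ _ _) dapp_Lq //.
apply: eq_big => [[P Q]|[P Q] /andP[_ nPQ]] /=.
  congr (_ && _); rewrite /signed_above /=.
  by rewrite [X in _ && X](_ : _ = true) ?andbT //; apply/forall_inP.
rewrite A_eval // /signed_term /= diffopZ scalerA; congr (_ *: _).
Qed.

End Evaluation.

Import Order.TTheory numFieldNormedType.Exports.

(** * The limits and the recurrence *)

Section Limits.
Local Open Scope classical_set_scope.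
Variable R : realType.

Lemma lim_affine (f : R -> R) (a c : R) :
  (forall x, f x = x^-1 * (x * a + c)) -> lim (f x @[x --> +oo]) = a.
Proof.
move=> /funext->.
apply/cvg_lim; first exact: norm_hausdorff.
apply/cvgrPdist_lt => e e0; near=> x.
have x0 : 0 < x by near: x; exact: nbhs_pinfty_gt.
have -> : a - x^-1 * (x * a + c) = - (c / x) by field; rewrite gt_eqF.
rewrite normrN normrM normfV (gtr0_norm x0) ltr_pdivrMr //.
rewrite mulrC -ltr_pdivrMr //.
by near: x; apply: nbhs_pinfty_gt; rewrite num_real.
Unshelve. all: by end_near.
Qed.

End Limits.

Section Final.
Variables (R : realType) (p : nat) (gamma : 'I_p.+1 -> R) (n : 'I_p -> nat).
Variables (j : nat) (hj : (0 < j <= p)%N).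
Implicit Types (s : multishift p) (N : R).

Let nr : 'I_p -> R := fun i => (n i)%:R.
Let proper (PQ : {set 'I_j} * {set 'I_j}) :=
  signed_above 0 PQ && (PQ.1 :|: PQ.2 != finset.set0).
Let sg (PQ : {set 'I_j} * {set 'I_j}) := first_sigma gamma n (signed_sites PQ.1 PQ.2).

Let kernel s (PQ : {set 'I_j} * {set 'I_j}) : R :=
  signed_term gamma n (chain_sum (V := R^o) gamma n (fun t => (t == s)%:R) 0) PQ.

Lemma dcoefE s beta0 N :
  dcoef (Ln R p j) s nr (beta_gamma gamma beta0) N =
  \sum_(PQ | proper PQ) (beta0 + N - sg PQ) * (N - sg PQ) * kernel s PQ.
Proof.
rewrite -[RHS](@dapp_Ln R p gamma n j hj R^o _ beta0 N) /dcoef /dapp big_mkcond /=.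
apply: eq_bigr => t _; case: eqP => _; first by rewrite -[_ *: _]/(_ * _) mulr1.
by rewrite scaler0.
Qed.

Lemma Ln_hatE s : Ln_hat gamma j s nr = \sum_(PQ | proper PQ) kernel s PQ.
Proof.
have tildeE N : Ln_tilde gamma j s nr N =
    \sum_(PQ | proper PQ) (N - sg PQ) * kernel s PQ.
  apply: (lim_affine
    (c := \sum_(PQ | proper PQ) (N - sg PQ) * (N - sg PQ) * kernel s PQ)) => b.
  rewrite dcoefE; congr (_ * _); rewrite mulr_sumr -big_split.
  by apply: eq_bigr => PQ _ /=; ring.
apply: (lim_affine (c := \sum_(PQ | proper PQ) - sg PQ * kernel s PQ)) => N.
rewrite tildeE; congr (_ * _); rewrite mulr_sumr -big_split.
by apply: eq_bigr => PQ _ /=; ring.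
Qed.

(** The two limits extract from a combination of the polynomials
    (beta_0 + N - S)(N - S) the coefficient of beta_0 N.  So does the mixed
    second difference, which in addition commutes with the action of the
    operator on functions with values in a module. *)
Lemma Ln_hat_mixed s :
  let c b N := dcoef (Ln R p j) s nr (beta_gamma gamma b) N in
  Ln_hat gamma j s nr = c 1 1 - c 0 1 - c 1 0 + c 0 0.
Proof.
rewrite /= Ln_hatE !dcoefE -!sumrB -big_split; apply: eq_bigr => PQ _ /=.
by ring.
Qed.

Lemma sum_dcoef (V : lmodType R) (L : dop R p) (h : multishift p -> V) x beta N :
  \sum_(s <- undup (unzip2 L)) dcoef L s x beta N *: h s = dapp L h x beta N.
Proof.
rewrite /dcoef; under eq_bigr do rewrite scaler_suml.
under eq_bigr do rewrite big_mkcond /=.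
rewrite exchange_big /= /dapp [LHS]big_seq [RHS]big_seq; apply: eq_bigr => t tL.
rewrite (bigD1_seq t.2) ?undup_uniq //=; last by rewrite mem_undup map_f.
by rewrite eqxx big1 ?addr0 // => s /negbTE; rewrite eq_sym => ->.
Qed.

Lemma Ln_hat_appE (V : lmodType R) (f : ('I_p -> nat) -> V) :
  Ln_hat_app gamma j f n =
  \sum_(PQ | proper PQ)
    signed_term gamma n (chain_sum gamma n (fun s => shifted f s n) 0) PQ.
Proof.
set h := fun s => shifted f s n.
transitivity (dapp (Ln R p j) h nr (beta_gamma gamma 1) 1
  - dapp (Ln R p j) h nr (beta_gamma gamma 0) 1
  - dapp (Ln R p j) h nr (beta_gamma gamma 1) 0
  + dapp (Ln R p j) h nr (beta_gamma gamma 0) 0).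
  rewrite -!sum_dcoef -!sumrB -big_split; apply: eq_bigr => s _ /=.
  by rewrite Ln_hat_mixed /= scalerDl !scalerBl.
rewrite !dapp_Ln // -!sumrB -big_split; apply: eq_bigr => PQ _ /=.
move: (signed_term _ _ _ PQ) => v.
by rewrite -!(scalerBl _ _ v) -(scalerDl v) -[RHS]scale1r; congr (_ *: _); ring.
Qed.

Hypothesis hgamma : Jpoly_defined gamma.

(** The sum over all signed subsets is minus the chain sum that starts
    from level p - j without a shift, hence - Z_1^{p+1-j} J_p; its term for
    the empty subset, which the operator lacks, is - J_p. *)
Lemma Ln_hat_Jpoly : Ln_defined gamma j nr ->
  Ln_hat_app gamma j (Jpoly gamma) n = kappa_hat R p j * Jpoly gamma n.
Proof.
move=> hn; have [j0 le_jp] := andP hj.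
rewrite Ln_hat_appE; set h := fun s => shifted (Jpoly gamma) s n.
have moved0 : moved n (0 : multishift p) = n.
  by apply: funext => i; rewrite /moved ffunE addr0.
have h0 : h 0 = Jpoly gamma n.
  rewrite /h /shifted; case: forallP => [_|]; last by case=> i; rewrite ffunE addr0.
  by rewrite -[X in Jpoly _ X]/(moved n 0) moved0.
have := signed_sum_collapse gamma n j h.
rewrite (bigD1 (finset.set0, finset.set0)) /=; last first.
  by apply/signed_aboveP; split=> i; rewrite !finset.inE.
rewrite {1}/signed_term /signed_sites /set_shifts finset.setU0 enum_set0 /=.
rewrite h0 scaleN1r => E.
have -> : \sum_(PQ | proper PQ) signed_term gamma n (chain_sum gamma n h 0) PQ =
    Jpoly gamma n - chain_sum gamma n h j 1 (level_quad gamma n (p - j) 1) 0.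
  rewrite -E addNKr.
  apply: eq_bigl => -[P Q]; rewrite /proper; congr (_ && _).
  by rewrite /= finset.setU_eq0 xpair_eqE.
rewrite chain_sum_Jpoly //; last first.
- by rewrite subrr /Defs.psum big1 // => i _; rewrite ffunE.
- by move=> i _; rewrite ffunE subrr.
- by move=> i _; rewrite ffunE.
- move=> k /andP[lt_k le_k]; have k0 : (0 < k)%N by apply: leq_ltn_trans lt_k.
  have lt_kp : (p - k < p)%N by lia.
  (* the denominators depend neither on beta_0 nor on N: any values will do *)
  have := hn 0 0 (Ordinal lt_kp); rewrite /= Ln_denominator /=.
  rewrite subKn // psum_nr => H.
  have {H} [] := H _; first by lia.
  by rewrite /Glev; rewrite addrA.
have -> : admissible n (p - j) 0.
  by apply/forallP => i; rewrite ffunE addr0 implybT.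
rewrite moved0 expr1 Jpoly_factor // -/(factor_prod gamma n 1 p.+1).
have -> : factor_prod gamma n 1 p.+1 =
    factor_prod gamma n 1 (p - j).+1 * factor_prod gamma n (p - j).+1 p.+1.
  by rewrite /factor_prod -big_cat_nat //= ltnS leq_subr.
rewrite /kappa_hat subSn //.
have -> : Defs.psum (fun i : 'I_p => mvar R i) (p - j).+1 = Zsum R p (p - j).+1.
  by rewrite /Zsum ifT //; lia.
by ring.
Qed.

End Final.

Theorem theorem5p4 (R : realType) (p : nat) (hp : (0 < p)%N)
    (gamma : 'I_p.+1 -> R) (hgamma : Jpoly_defined gamma)
    (n : 'I_p -> nat) (j : nat) (hj : (1 <= j <= p)%N) :
  Lz gamma j (Jpoly gamma n) = mu_hat gamma n j *: Jpoly gamma n /\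
  (Ln_defined gamma j (fun i => (n i)%:R) ->
   Ln_hat_app gamma j (Jpoly gamma) n = kappa_hat R p j * Jpoly gamma n).
Proof. by split; [exact: Lz_Jpoly | exact: Ln_hat_Jpoly]. Qed.
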